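(* For every constant $w$, Plan Verification is solvable in polynomial time on instances whose initial task network $(T,\prec^+,\alpha)$ is primitive and has generalized partial order width at most $w$.
   Context: An HTN domain is a tuple $D=(F,A,\mathcal{C},\delta,M)$ where $F$ is a finite set of propositions, $A$ a set of actions, $\mathcal{C}$ a set of compound task names disjoint from $A$, $\delta$ maps each action $a$ to $(\mathrm{pre}(a),\mathrm{del}(a),\mathrm{add}(a))$, subsets of $F$, and $M$ gives decomposition methods. Action $a$ is executable in state $s\subseteq F$ if $\mathrm{pre}(a)\subseteq s$; executing it yields $(s\setminus\mathrm{del}(a))\cup\mathrm{add}(a)$; a plan (action sequence) is executable in $s$ if its actions can be executed consecutively from $s$. A task network is $(T,\prec^+,\alpha)$ with $T$ finite, $\prec^+$ a strict partial order on $T$, $\alpha:T\to A\cup\mathcal{C}$; primitive if $\alpha(T)\subseteq A$. A linearization is a total order $\bar t$ of $T$ extending $\prec^+$, with action sequence $\alpha(\bar t)$. Plan Verification (for a primitive network $tn$): given $tn$, an initial state $s_0\subseteq F$ and a plan $p$ over $A$, decide whether $tn$ has a linearization $\bar t$ with $\alpha(\bar t)=p$ and $p$ executable in $s_0$. The partial order width of a partial order is the size of its largest antichain. An element is isolated if it is incomparable to every other element. The generalized partial order width of $\prec^+$ is the partial order width of $\prec^+$ restricted to the non-isolated elements. *)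

(* Defs.v *)
From mathcomp Require Import all_boot.
Set Implicit Arguments. Unset Strict Implicit. Unset Printing Implicit Defensive.

(* An action a with (pre(a), del(a), add(a)); propositions are naturals   *)
(* below [inst_nprops], i.e. F = {0, ..., nprops - 1}.                     *)
Record action := Action { act_pre : seq nat; act_del : seq nat; act_add : seq nat }.

(* An instance: F (via its size), the actions A (identified by their      *)
(* index in [inst_actions]), a primitive task network (T, <+, alpha) with *)
(* T = {0, ..., size inst_labels - 1}, alpha t = nth 0 inst_labels t, and *)
(* <+ given as the list of pairs (t, t') with t <+ t'; the initial state  *)
(* s0 and the plan p (a sequence of action indices).                      *)
Record instance := Instance {
  inst_nprops  : nat;
  inst_actions : seq action;
  inst_labels  : seq nat;
  inst_order   : seq (nat * nat);
  inst_init    : seq nat;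
  inst_plan    : seq nat }.

Definition ntasks (I : instance) : nat := size (inst_labels I).
Definition prec (I : instance) (t t' : nat) : bool := (t, t') \in inst_order I.
Definition alpha (I : instance) (t : nat) : nat := nth 0 (inst_labels I) t.
Definition action_of (I : instance) (k : nat) : action :=
  nth (Action [::] [::] [::]) (inst_actions I) k.

Definition props_ok (I : instance) (s : seq nat) : bool :=
  all (fun f => f < inst_nprops I) s.

Definition wf_instance (I : instance) : Prop :=
  [/\ all (fun a => [&& props_ok I (act_pre a), props_ok I (act_del a)
                       & props_ok I (act_add a)]) (inst_actions I),
      props_ok I (inst_init I),
      all (fun k => k < size (inst_actions I)) (inst_labels I) &
      all (fun k => k < size (inst_actions I)) (inst_plan I)] /\
  [/\ all (fun tt => (tt.1 < ntasks I) && (tt.2 < ntasks I)) (inst_order I),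
      (forall t, ~~ prec I t t) &
      (forall t1 t2 t3, prec I t1 t2 -> prec I t2 t3 -> prec I t1 t3)].

(* States s ⊆ F are represented by their membership predicate. *)
Definition apply_action (a : action) (s : nat -> bool) : nat -> bool :=
  fun f => (s f && (f \notin act_del a)) || (f \in act_add a).

Fixpoint executable (s : nat -> bool) (p : seq action) : bool :=
  match p with
  | [::] => true
  | a :: r => all s (act_pre a) && executable (apply_action a s) r
  end.

Definition is_linearization (I : instance) (lin : seq nat) : bool :=
  perm_eq lin (iota 0 (ntasks I)) &&
  all (fun tt => index tt.1 lin < index tt.2 lin) (inst_order I).

Definition PV_yes (I : instance) : Prop :=
  exists lin : seq nat,
    [/\ is_linearization I lin,
        map (alpha I) lin = inst_plan I &
        executable (fun f => f \in inst_init I) (map (action_of I) (inst_plan I))].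

Definition nonisolated (I : instance) (t : 'I_(ntasks I)) : bool :=
  [exists t' : 'I_(ntasks I), (t' != t) && (prec I t t' || prec I t' t)].

Definition antichain_noniso (I : instance) (S : {set 'I_(ntasks I)}) : bool :=
  [forall t in S, nonisolated t] &&
  [forall t in S, forall t' in S, (t != t') ==> (~~ prec I t t' && ~~ prec I t' t)].

Definition gpo_width (I : instance) : nat :=
  \max_(S : {set 'I_(ntasks I)} | antichain_noniso S) #|S|.

(* Encoding of instances as words over the alphabet {1,2,3,4}             *)
(* (1 = unary digit, 2 = end of number, 3 = '[', 4 = ']').                 *)
(* All numbers occurring are bounded by |F|, |A| or |T|, so unary coding  *)
(* is polynomially equivalent to a standard binary encoding.              *)
Definition enc_nat (n : nat) : seq nat := nseq n 1 ++ [:: 2].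
Definition enc_list (T : Type) (f : T -> seq nat) (xs : seq T) : seq nat :=
  [:: 3] ++ flatten (map f xs) ++ [:: 4].
Definition enc_pair (tt : nat * nat) : seq nat := enc_nat tt.1 ++ enc_nat tt.2.
Definition enc_action (a : action) : seq nat :=
  enc_list enc_nat (act_pre a) ++ enc_list enc_nat (act_del a)
  ++ enc_list enc_nat (act_add a).
Definition encode (I : instance) : seq nat :=
  enc_nat (inst_nprops I) ++ enc_list enc_action (inst_actions I)
  ++ enc_list enc_nat (inst_labels I) ++ enc_list enc_pair (inst_order I)
  ++ enc_list enc_nat (inst_init I) ++ enc_list enc_nat (inst_plan I).

(* Deterministic single-tape Turing machines (two-way infinite tape,      *)
(* blank symbol 0, states {0..nstates-1}, symbols {0..nsyms-1}).           *)
Inductive dir := Lft | Rgt | Stay.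

Record TM := MkTM {
  tm_nstates : nat;
  tm_nsyms   : nat;
  tm_start   : nat;
  tm_accept  : nat;
  tm_reject  : nat;
  tm_delta   : nat -> nat -> nat * nat * dir }.

Definition tm_wf (M : TM) : Prop :=
  [/\ tm_start M < tm_nstates M, tm_accept M < tm_nstates M,
      tm_reject M < tm_nstates M, tm_accept M != tm_reject M &
      forall q a, q < tm_nstates M -> a < tm_nsyms M ->
        ((tm_delta M q a).1.1 < tm_nstates M) && ((tm_delta M q a).1.2 < tm_nsyms M)].

(* configuration: state, tape left of head (nearest first), head symbol, *)
(* tape right of head.                                                    *)
Record config := Config { cstate : nat; cleft : seq nat; chead : nat; cright : seq nat }.

Definition halted (M : TM) (c : config) : bool :=
  (cstate c == tm_accept M) || (cstate c == tm_reject M).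

Definition step (M : TM) (c : config) : config :=
  if halted M c then c else
  let: (q', b, d) := tm_delta M (cstate c) (chead c) in
  match d with
  | Lft => match cleft c with
           | [::] => Config q' [::] 0 (b :: cright c)
           | x :: l => Config q' l x (b :: cright c)
           end
  | Rgt => match cright c with
           | [::] => Config q' (b :: cleft c) 0 [::]
           | x :: r => Config q' (b :: cleft c) x r
           end
  | Stay => Config q' (cleft c) b (cright c)
  end.

Definition init_config (M : TM) (x : seq nat) : config :=
  match x with
  | [::] => Config (tm_start M) [::] 0 [::]
  | a :: r => Config (tm_start M) [::] a r
  end.

Definition run (M : TM) (t : nat) (x : seq nat) : config :=
  iter t (step M) (init_config M x).

(* Main.v *)
(* A task network is verified by dynamic programming over the plan.  Isolated
   tasks are unconstrained, so once the labels of the tasks are known to be a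
   permutation of the plan it is enough to embed the non-isolated tasks, in some
   order extending the partial order, as a subsequence of the plan.  Scanning the
   plan, one maintains the list of all down-closed sets of tasks which contain
   the isolated ones and can have been scheduled so far.  Such a set is determined
   by the antichain of its maximal non-isolated elements, so there are at most
   (n + 1) ^ w of them.

   The algorithm is a program over unary registers and arrays of digits.  These
   live on the tracks of the tape, left-justified next to a blank home cell, so
   that each operation is a single scan to the right followed by a return.  Every
   nested loop runs at most [Q] times, where [Q] bounds all register values, so
   the number of operations is at most [Q ^ d], with [d] read off the syntax. *)
Require Import Defs.
From mathcomp Require Import all_boot.
From mathcomp Require Import zify.
From Stdlib Require Import FunctionalExtensionality.
Set Implicit Arguments. Unset Strict Implicit. Unset Printing Implicit Defensive.

(** The claim concerns a concrete single-tape machine, so cost is tracked down to head moves. An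
    operation takes time linear in the register it scans, and a register grows by at most one per
    operation; a bound on the number of operations therefore gives a quadratic bound on the time.
    [Q] occurs only in the analysis: the program knows neither [Q] nor [w], one machine serves every
    width, and only the exponent of its running time depends on [w].

    Two measures keep the list of sets short. A new set is stored only if it differs from all stored
    ones, since repetitions could multiply with every action; and isolated tasks belong to every set
    from the start, since otherwise their subsets alone could be exponentially many. The price is
    that a set no longer records which actions are left to isolated tasks. It may be greedy, because
    only the multiset of labels matters there, and it need not agree with the tasks chosen for the
    sets. *)

Record store := Store { rg : nat -> nat; ar : nat -> nat -> nat }.

Definition setr x v s :=
  Store (fun y => if y == x then v else rg s y) (ar s).
Definition seta a i d s :=
  Store (rg s) (fun b j => if (b == a) && (j == i) then d else ar s b j).

Inductive test := TLt of nat & nat | TArr of nat & nat & nat.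
Inductive prim := PInc of nat | PClr of nat | PWr of nat & nat & nat.
Inductive cmd :=
  | Skip | Prim of prim | Seq of cmd & cmd | If of test & cmd & cmd
  | While of test & cmd.

Definition tsem t s :=
  match t with
  | TLt x y => rg s x < rg s y
  | TArr a x d => ar s a (rg s x) == d
  end.

Definition psem p s :=
  match p with
  | PInc x => setr x (rg s x).+1 s
  | PClr x => setr x 0 s
  | PWr a x d => seta a (rg s x) d s
  end.

(** The number counts executed instructions of the compiled code, jumps included. The true branch of
    [If] pays for the test and for the jump over the other branch, a round of [While] for the test
    and for the jump back. *)
Inductive exec : cmd -> store -> nat -> store -> Prop :=
  | XSkip s : exec Skip s 0 s
  | XPrim p s : exec (Prim p) s 1 (psem p s)
  | XSeq c1 c2 s n1 s1 n2 s2 :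
      exec c1 s n1 s1 -> exec c2 s1 n2 s2 -> exec (Seq c1 c2) s (n1 + n2) s2
  | XIfT t c1 c2 s n s' :
      tsem t s -> exec c1 s n s' -> exec (If t c1 c2) s n.+2 s'
  | XIfF t c1 c2 s n s' :
      ~~ tsem t s -> exec c2 s n s' -> exec (If t c1 c2) s n.+1 s'
  | XWhileF t c s : ~~ tsem t s -> exec (While t c) s 1 s
  | XWhileT t c s n1 s1 n2 s2 :
      tsem t s -> exec c s n1 s1 -> exec (While t c) s1 n2 s2 ->
      exec (While t c) s (n1 + n2).+2 s2.

(** * Symbols as vectors of base-5 digits *)

(** Digit [j] is the content of track [j]. Base 5 fits the input alphabet with its blank: a raw
    input symbol is already a cell with that symbol on track 0 and blanks elsewhere, so the
    unmodified input is array 0. *)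
Fixpoint dig s j := if j is j'.+1 then dig (s %/ 5) j' else s %% 5.
Fixpoint pack K (f : nat -> nat) :=
  if K is K'.+1 then f 0 %% 5 + 5 * pack K' (fun j => f j.+1) else 0.

Lemma dig_lt s j : dig s j < 5.
Proof. by elim: j s => [|j IH] s /=; rewrite ?ltn_pmod. Qed.

Lemma dig_pack K f j : j < K -> dig (pack K f) j = f j %% 5.
Proof.
elim: K f j => // K IH f [|j] /= ltjK.
  by rewrite mulnC addnC modnMDl modn_mod.
by rewrite mulnC addnC divnMDl // divn_small ?ltn_pmod // addn0 IH.
Qed.

Lemma pack_lt K f : pack K f < 5 ^ K.
Proof.
elim: K f => // K IH f /=; rewrite expnS.
have := IH (fun j => f j.+1); have : f 0 %% 5 < 5 by rewrite ltn_pmod.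
lia.
Qed.

Lemma dig0 j : dig 0 j = 0.
Proof. by elim: j => //= j; rewrite div0n. Qed.

Lemma dig_small a j : a < 5 -> dig a j = if j == 0 then a else 0.
Proof. by move=> lta; case: j => [|j] /=; rewrite ?modn_small // divn_small // dig0. Qed.

Arguments dig : simpl never.

(** * Instructions and their microcode *)

(** [IJ t l] falls through when [t] holds and jumps to [l] otherwise. *)
Inductive instr := IP of prim | IJ of test & nat.

(* Array [a] lives on track 2a and register [x], in unary, on track 2x+1. *)
Definition atrack (a : nat) := a.*2.
Definition rtrack (x : nat) := x.*2.+1.

Definition set_dig K s j d := pack K (fun j' => if j' == j then d else dig s j').

Lemma dig_set K s j d j' : j' < K -> d < 5 ->
  dig (set_dig K s j d) j' = if j' == j then d else dig s j'.
Proof.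
by move=> ltj ltd; rewrite dig_pack //; case: eqP => _; rewrite modn_small // dig_lt.
Qed.

Definition ireg i :=
  match i with
  | IP (PInc x) | IP (PClr x) | IP (PWr _ x _)
  | IJ (TLt x _) _ | IJ (TArr _ x _) _ => x
  end.
(** The unary marks of the scanned register fill the cells next to home and home carries none, so
    they guide the head back. *)
Definition iback i a := dig a (rtrack (ireg i)) != 0.
(** A comparison stops at the smaller of its two registers. All cells crossed then carry marks of
    the first one, which suffices for the return. *)
Definition iscan i a :=
  iback i a && (if i is IJ (TLt _ y) _ then dig a (rtrack y) != 0 else true).
Definition iwrite K i a :=
  match i with
  | IP (PInc x) => set_dig K a (rtrack x) 1
  | IP (PWr b _ d) => set_dig K a (atrack b) d
  | _ => a
  end.
Definition itest i a :=
  match i with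
  | IP _ => true
  | IJ (TLt x y) _ => (dig a (rtrack x) == 0) && (dig a (rtrack y) != 0)
  | IJ (TArr b _ d) _ => dig a (atrack b) == d
  end.
Definition ierase K i a := if i is IP (PClr x) then set_dig K a (rtrack x) 0 else a.
Definition itarget i pc (b : bool) :=
  if b then pc.+1 else if i is IJ _ l then l else pc.+1.

Definition default_instr := IP (PInc 0).

(** State [4 * pc + r] is phase [r] of instruction [pc]: 0 leaves home, 1 scans right, 2 and 3
    return after a false or a true test. Address [len] accepts and [len.+1] rejects; jump targets
    are capped there so that states stay in range for every program. The start state steps left
    once, which creates the blank home cell in front of the input. *)
Definition tm_trans K prog q a : nat * nat * dir :=
  let len := size prog in
  if q == (4 * len).+1 then (0, a, Lft)
  else if q < 4 * len then
    let pc := q %/ 4 in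
    let i := nth default_instr prog pc in
    match q %% 4 with
    | 0 => (q.+1, a, Rgt)
    | 1 => if iscan i a then (q, a, Rgt)
           else (4 * pc + 2 + itest i a, iwrite K i a, Lft)
    | r => if iback i a then (q, ierase K i a, Lft)
           else (4 * minn (itarget i pc (r == 3)) len.+1, a, Stay)
    end
  else (q, a, Stay).

Definition machine K prog :=
  MkTM (4 * (size prog).+2) (5 ^ K) (4 * size prog).+1
       (4 * size prog) (4 * (size prog).+1) (tm_trans K prog).

Lemma iwrite_lt K i a : a < 5 ^ K -> iwrite K i a < 5 ^ K.
Proof. by case: i => [[x|x|b x d]|[x y|b x d] l] //= _; apply: pack_lt. Qed.

Lemma ierase_lt K i a : a < 5 ^ K -> ierase K i a < 5 ^ K.
Proof. by case: i => [[x|x|b x d]|[x y|b x d] l] //= _; apply: pack_lt. Qed.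

Lemma machine_wf K prog : tm_wf (machine K prog).
Proof.
split=> /=; try lia.
move=> q a ltq lta; rewrite /tm_trans.
case: eqP => [_|_] /=; first by lia.
case: (ltnP q (4 * size prog)) => [ltq4|_] /=; last by rewrite lta andbT.
set i := nth _ _ _.
have ltwr := iwrite_lt i lta; have ltbw := ierase_lt i lta.
case def_r: (q %% 4) => [|[|r]] /=.
- by rewrite lta andbT; lia.
- case: (iscan i a) => /=; rewrite ?ltwr ?lta ?andbT //.
  by case: itest => /=; clear -ltq4; lia.
- case: (iback i a) => /=; rewrite ?ltbw ?lta ?andbT //.
  by clear; lia.
Qed.

(** * Single steps on a one-way infinite tape *)

(** Cells left of position 0 are never visited, so the left part is known exactly; the right part is
    fixed only up to trailing blanks. *)
Definition config_at c q (f : nat -> nat) i :=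
  [/\ cstate c = q, cleft c = rev (mkseq f i), chead c = f i
    & forall j, nth 0 (cright c) j = f (i.+1 + j)].

Definition fupd (f : nat -> nat) i b := fun j => if j == i then b else f j.

Lemma fupd_id f i : fupd f i (f i) = f.
Proof. by apply: functional_extensionality => j; rewrite /fupd; case: eqP => [->|]. Qed.

Lemma mkseq_fupd f i b n : n <= i -> mkseq (fupd f i b) n = mkseq f n.
Proof.
move=> leni; apply/eq_in_map => j; rewrite mem_iota /fupd /= add0n => ltj.
by rewrite ltn_eqF // (leq_trans ltj).
Qed.

Section Steps.
Variables (M : TM) (c : config) (q q' : nat) (f : nat -> nat) (i b : nat).
Hypothesis nh : (q != tm_accept M) && (q != tm_reject M).

Lemma config_at_right : config_at c q f i -> tm_delta M q (f i) = (q', b, Rgt) ->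
  config_at (step M c) q' (fupd f i b) i.+1.
Proof.
case=> cs cl ch cr dq; rewrite /step /halted cs ch dq.
have := nh; rewrite -negb_or => /negbTE ->.
have E k : fupd f i b (i.+1 + k) = f (i.+1 + k).
  by rewrite /fupd gtn_eqF //; lia.
have L : b :: cleft c = rev (mkseq (fupd f i b) i.+1).
  by rewrite cl mkseqS rev_rcons mkseq_fupd // /fupd eqxx.
case def_r: (cright c) cr => [|x r] cr; split=> //=.
- by rewrite -[i.+1]addn0 E -cr.
- by move=> j; rewrite nth_nil addSnnS E -cr nth_nil.
- by rewrite -[i.+1]addn0 E -cr.
- by move=> j; rewrite addSnnS E -cr.
Qed.

Lemma config_at_left : config_at c q f i.+1 -> tm_delta M q (f i.+1) = (q', b, Lft) ->
  config_at (step M c) q' (fupd f i.+1 b) i.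
Proof.
case=> cs cl ch cr dq; rewrite /step /halted cs ch dq.
have := nh; rewrite -negb_or => /negbTE ->.
rewrite cl mkseqS rev_rcons.
split=> //=; first by rewrite mkseq_fupd.
- by rewrite /fupd ltn_eqF.
- case=> [|j] /=; rewrite /fupd ?addn0 ?eqxx // cr gtn_eqF; last by lia.
  by congr f; lia.
Qed.

Lemma config_at_stay : config_at c q f i -> tm_delta M q (f i) = (q', b, Stay) ->
  config_at (step M c) q' (fupd f i b) i.
Proof.
case=> cs cl ch cr dq; rewrite /step /halted cs ch dq.
have := nh; rewrite -negb_or => /negbTE ->.
split=> //=; first by rewrite mkseq_fupd.
- by rewrite /fupd eqxx.
- by move=> j; rewrite cr /fupd gtn_eqF //; lia.
Qed.

End Steps.

(** * One instruction carried out by its four machine states *)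

Section Simulation.

Variables (K : nat) (prog : seq instr).
Local Notation M := (machine K prog).
Local Notation stepn m c := (iter m (step M) c).

Definition reaches c n (P : config -> Prop) :=
  exists m, m <= n /\ P (stepn m c).

Lemma reaches_trans c n1 n2 (P Q : config -> Prop) :
  reaches c n1 P -> (forall c', P c' -> reaches c' n2 Q) -> reaches c (n1 + n2) Q.
Proof.
case=> m1 [le1 /[swap] H /H [m2 [le2 HQ]]]; exists (m2 + m1).
by rewrite iterD; split=> //; lia.
Qed.

Lemma reaches1 c (P : config -> Prop) : P (step M c) -> reaches c 1 P.
Proof. by exists 1. Qed.

Lemma reachesW c n1 n2 (P : config -> Prop) :
  n1 <= n2 -> reaches c n1 P -> reaches c n2 P.
Proof. by move=> le12 [m [lem HP]]; exists m; split=> //; apply: leq_trans le12. Qed.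

Section OneInstruction.

Variable pc : nat.
Hypothesis ltpc : pc < size prog.
Let i := nth default_instr prog pc.

Lemma trans_ph r a : r < 4 -> tm_trans K prog (4 * pc + r) a =
  match r with
  | 0 => ((4 * pc + r).+1, a, Rgt)
  | 1 => if iscan i a then (4 * pc + r, a, Rgt)
         else (4 * pc + 2 + itest i a, iwrite K i a, Lft)
  | r => if iback i a then (4 * pc + r, ierase K i a, Lft)
         else (4 * minn (itarget i pc (r == 3)) (size prog).+1, a, Stay)
  end.
Proof.
move=> ltr; rewrite /tm_trans.
have -> : (4 * pc + r == (4 * size prog).+1) = false by apply/eqP; lia.
have -> : 4 * pc + r < 4 * size prog by lia.
have -> : (4 * pc + r) %/ 4 = pc by lia.
have -> : (4 * pc + r) %% 4 = r by lia.
by case: r {ltr} => [|[|r]].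
Qed.

Lemma nhalt_ph r : r < 4 ->
  (4 * pc + r != tm_accept M) && (4 * pc + r != tm_reject M).
Proof. by move=> ltr; apply/andP; split; apply/eqP => /=; lia. Qed.

Lemma scan_ok v c f j : config_at c (4 * pc + 1) f j ->
  (forall k, k < v -> iscan i (f (j + k))) ->
  reaches c v (fun c' => config_at c' (4 * pc + 1) f (j + v)).
Proof.
elim: v c j => [|v IH] c j Ac sc; first by exists 0; rewrite addn0.
rewrite -[v.+1]add1n; apply: (@reaches_trans _ _ _ (fun c' => config_at c' (4 * pc + 1) f j.+1)).
  apply: reaches1; rewrite -[f](fupd_id _ j).
  apply: config_at_right Ac _; first exact: nhalt_ph.
  by rewrite /= trans_ph // -[j]addn0 sc.
move=> c' Ac'; rewrite addnA (addn1 j); apply: IH => // k ltk.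
by rewrite addSnnS; apply: sc.
Qed.

Lemma back_ok v r c f : 2 <= r < 4 -> config_at c (4 * pc + r) f v ->
  (forall k, 0 < k <= v -> iback i (f k)) -> ~~ iback i (f 0) ->
  reaches c v.+1 (fun c' =>
    config_at c' (4 * minn (itarget i pc (r == 3)) (size prog).+1)
       (fun k => if 0 < k <= v then ierase K i (f k) else f k) 0).
Proof.
move=> /andP[le2r ltr4]; elim: v c f => [|v IH] c f Ac bk nb.
  apply: reaches1.
  have -> : (fun k => if 0 < k <= 0 then ierase K i (f k) else f k) = fupd f 0 (f 0).
    by rewrite fupd_id; apply: functional_extensionality => -[].
  apply: config_at_stay Ac _; first exact: nhalt_ph.
  rewrite /= trans_ph //.
  by case: (r) le2r => [|[|r']] // _; rewrite (negbTE nb).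
rewrite -[v.+2]add1n.
apply: (@reaches_trans _ _ _
  (fun c' => config_at c' (4 * pc + r) (fupd f v.+1 (ierase K i (f v.+1))) v)).
  apply: reaches1; apply: config_at_left Ac _; first exact: nhalt_ph.
  rewrite /= trans_ph //.
  by case: (r) le2r => [|[|r']] // _; rewrite bk ?leqnn.
move=> c' Ac'.
have [||m [lem Am]] := IH _ _ Ac'.
- by move=> k /andP[k0 lek]; rewrite /fupd ltn_eqF ?bk ?k0 //=; lia.
- by rewrite /fupd.
exists m; split=> //; congr config_at: Am.
apply: functional_extensionality => k; rewrite /fupd.
case: eqP => [->|ne]; first by rewrite ltnn leqnn.
by have -> : (k <= v.+1) = (k <= v) by lia.
Qed.

(** The steps are one to leave home, [v] to scan, one to write and turn, [v] to walk back, and a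
    last one at home that only changes the state. *)
Lemma microcode_ok v c f : config_at c (4 * pc) f 0 ->
  (forall k, k < v -> iscan i (f k.+1)) -> ~~ iscan i (f v.+1) -> f 0 = 0 ->
  reaches c (2 * v + 3) (fun c' =>
    config_at c' (4 * minn (itarget i pc (itest i (f v.+1))) (size prog).+1)
       (fun k => if 0 < k <= v then ierase K i (f k)
                 else if k == v.+1 then iwrite K i (f k) else f k) 0).
Proof.
move=> Ac sc nsc f0.
have bk k : k < v -> iback i (f k.+1) by move=> /sc /andP[].
have -> : 2 * v + 3 = 1 + (v + (1 + v.+1)) by lia.
apply: (@reaches_trans _ _ _ (fun c' => config_at c' (4 * pc + 1) f 1)).
  apply: reaches1; rewrite -[f](fupd_id _ 0).
  rewrite -[4 * pc]addn0 in Ac.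
  apply: config_at_right Ac _; first exact: nhalt_ph.
  by rewrite /= trans_ph // addn0 addn1.
move=> c1 A1; apply: reaches_trans (scan_ok (v := v) A1 _) _ => //.
rewrite add1n => c2 A2.
apply: (@reaches_trans _ _ _ (fun c' =>
  config_at c' (4 * pc + (2 + itest i (f v.+1))) (fupd f v.+1 (iwrite K i (f v.+1))) v)).
  apply: reaches1; apply: config_at_left A2 _; first exact: nhalt_ph.
  by rewrite /= trans_ph // (negbTE nsc) addnA.
move=> c3 A3.
have [|||m [lem Am]] := back_ok _ A3.
- by case: itest.
- by case=> // k /andP[_ ltk]; rewrite /fupd ltn_eqF ?bk.
- by rewrite /fupd /= f0 /iback dig0.
exists m; split=> //; congr config_at: Am; first by case: itest.
apply: functional_extensionality => k; rewrite /fupd.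
by case: (ltngtP k v.+1) => [ltk|ltk|->]; rewrite ?ltnn ?andbF.
Qed.

End OneInstruction.

Definition track s j k :=
  if odd j then nat_of_bool (k < rg s j./2) else ar s j./2 k.

Definition tape_of f s :=
  f 0 = 0 /\ forall k j, j < K -> dig (f k.+1) j = track s j k.

Definition prim_ok p :=
  match p with
  | PInc x | PClr x => rtrack x < K
  | PWr a x d => [&& atrack a < K, rtrack x < K & d < 5]
  end.
Definition test_ok t :=
  match t with
  | TLt x y => (rtrack x < K) && (rtrack y < K)
  | TArr a x d => (atrack a < K) && (rtrack x < K)
  end.
Definition instr_valid i :=
  match i with IP p => prim_ok p | IJ t _ => test_ok t end.

Definition isem i s := if i is IP p then psem p s else s.
Definition inext i pc s :=
  if i is IJ t l then if tsem t s then pc.+1 else l else pc.+1.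

Lemma track_rtrack s x k : track s (rtrack x) k = (k < rg s x).
Proof. by rewrite /track /rtrack /= odd_double /= uphalf_double. Qed.

Lemma track_atrack s a k : track s (atrack a) k = ar s a k.
Proof. by rewrite /track /atrack odd_double doubleK. Qed.

Lemma track_setr s x v j k :
  track (setr x v s) j k = if j == rtrack x then nat_of_bool (k < v) else track s j k.
Proof.
rewrite /track /rtrack; have := odd_double_half j.
case: (odd j) => /= <-; last by rewrite add0n; case: eqP => //; lia.
rewrite add1n eqSS /= uphalf_double.
by case: (altP (j./2 =P x)) => [->|ne]; rewrite ?eqxx //; case: eqP => //; lia.
Qed.

Lemma track_seta s a i d j k :
  track (seta a i d s) j k = if (j == atrack a) && (k == i) then d else track s j k.
Proof.
rewrite /track /atrack; have := odd_double_half j.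
case: (odd j) => /= <-; first by case: eqP => //; lia.
rewrite add0n /= doubleK.
by rewrite -!muln2 eqn_pmul2r.
Qed.

Lemma instr_ok pc c f s : pc < size prog -> let i := nth default_instr prog pc in
  instr_valid i -> config_at c (4 * pc) f 0 -> tape_of f s ->
  reaches c (2 * rg s (ireg i) + 3) (fun c' => exists f',
    config_at c' (4 * minn (inext i pc s) (size prog).+1) f' 0 /\ tape_of f' (isem i s)).
Proof.
move=> ltpc i vi Ac [f0 rf].
have dr x k : rtrack x < K -> dig (f k.+1) (rtrack x) = (k < rg s x).
  by move=> ltx; rewrite rf // track_rtrack.
have da a k : atrack a < K -> dig (f k.+1) (atrack a) = ar s a k.
  by move=> lta; rewrite rf // track_atrack.
have vm : rtrack (ireg i) < K.
  move: vi; case: (i) => [[x|x|b x d]|[x y|b x d] l] //=.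
  - by case/and3P.
  - by case/andP.
  - by case/andP.
have [v def_v] : exists v, v = if i is IJ (TLt x y) _ then minn (rg s x) (rg s y)
  else rg s (ireg i) by eexists.
have lev : v <= rg s (ireg i).
  by rewrite def_v; case: (i) => [[x|x|b x d]|[x y|b x d] l] //=; apply: geq_minl.
have sc k : iscan i (f k.+1) = (k < v).
  rewrite /iscan /iback dr // def_v; move: vi vm; case: (i) => [[x|x|b x d]|[x y|b x d] l] /= vi vm;
    rewrite ?andbT ?eqb0 ?negbK //.
  by case/andP: vi => _ vy; rewrite dr // eqb0 negbK leq_min.
have [||m [lem Am]] := microcode_ok (v := v) ltpc Ac _ _ f0.
- by move=> k; rewrite sc.
- by rewrite sc ltnn.
exists m; split; first by lia.
set f' := (X in config_at _ _ X) in Am; exists f'; split.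
  congr config_at: Am; congr (4 * minn _ _).
  rewrite -/i /inext /itest /itarget; move: vi vm def_v; case: (i) => [[x|x|b x d]|[x y|b x d] l] //= vi vm
    def_v.
    case/andP: vi => vx vy; rewrite !dr // !eqb0 negbK.
    rewrite def_v -!leqNgt; congr (if _ then _ else _); apply/idP/idP; lia.
  by case/andP: vi => va _; rewrite da // def_v.
split; first by rewrite /f'.
move=> k j ltj; rewrite /f' /= eqSS -/i.
move: vi vm def_v; case: (i) => [[x|x|b x d]|t l] //= vi vm def_v.
- rewrite track_setr; case: (ltngtP k v) => [ltk|ltk|->]; rewrite ?dig_set //.
  + rewrite rf //; case: (j =P rtrack x) => [->|//]; rewrite track_rtrack; lia.
  + rewrite rf //; case: (j =P rtrack x) => [->|//]; rewrite track_rtrack; lia.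
  + rewrite rf //; case: (j =P rtrack x) => [_|//]; lia.
- rewrite track_setr ltn0; case: (ltngtP k v) => [ltk|ltk|->]; rewrite ?dig_set ?rf //.
  + case: (j =P rtrack x) => [->|//]; rewrite track_rtrack; lia.
  + case: (j =P rtrack x) => [->|//]; rewrite track_rtrack; lia.
- case/and3P: vi => vb vx vd; rewrite track_seta -def_v.
  by case: (ltngtP k v) => [ltk|ltk|->]; rewrite ?dig_set ?rf ?andbF ?andbT.
- by rewrite !if_same rf; case: t {vi vm def_v}.
Qed.

End Simulation.

(** * Compilation of structured programs *)

(* [TLt 0 0] never holds, so [IJ (TLt 0 0) l] is an unconditional jump. *)
Definition goto l := IJ (TLt 0 0) l.

(** Jumps are absolute, hence the argument [b], the address of the first instruction. *)
Fixpoint compile b c : seq instr :=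
  match c with
  | Skip => [::]
  | Prim p => [:: IP p]
  | Seq c1 c2 =>
      let l1 := compile b c1 in l1 ++ compile (b + size l1) c2
  | If t c1 c2 =>
      let l1 := compile b.+1 c1 in
      let b2 := (b + size l1).+2 in
      let l2 := compile b2 c2 in
      IJ t b2 :: l1 ++ goto (b2 + size l2) :: l2
  | While t c =>
      let l := compile b.+1 c in
      IJ t (b + size l).+2 :: l ++ [:: goto b]
  end.

Fixpoint cmd_ok K c :=
  match c with
  | Skip => true
  | Prim p => prim_ok K p
  | Seq c1 c2 => cmd_ok K c1 && cmd_ok K c2
  | If t c1 c2 => [&& test_ok K t, cmd_ok K c1 & cmd_ok K c2]
  | While t c => test_ok K t && cmd_ok K c
  end.

Definition code_at (prog : seq instr) b l := exists l1 l2, prog = l1 ++ l ++ l2 /\ size l1 = b.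

Lemma code_at_catl prog b l l' : code_at prog b (l ++ l') -> code_at prog b l.
Proof. by case=> l1 [l2 [-> sz]]; exists l1, (l' ++ l2); rewrite -catA. Qed.

Lemma code_at_catr prog b l l' :
  code_at prog b (l ++ l') -> code_at prog (b + size l) l'.
Proof.
case=> l1 [l2 [-> sz]]; exists (l1 ++ l), l2.
by rewrite size_cat sz -!catA.
Qed.

Lemma code_at_hd prog b i l : code_at prog b (i :: l) ->
  b < size prog /\ nth default_instr prog b = i.
Proof.
case=> l1 [l2 [-> <-]]; rewrite size_cat nth_cat ltnn subnn /=.
by split=> //; lia.
Qed.

Lemma code_at_size prog b l : code_at prog b l -> b + size l <= size prog.
Proof. by case=> l1 [l2 [-> <-]]; rewrite !size_cat; lia. Qed.

Definition rbound v s := forall x, rg s x <= v.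

Lemma rbound_psem v p s : rbound v s -> rbound v.+1 (psem p s).
Proof.
move=> bs; case: p => [x|x|a x d] y /=; last by rewrite (leq_trans (bs y)).
  by case: eqP => _; rewrite ?ltnS ?(leq_trans (bs y)).
by case: eqP => _; rewrite ?(leq_trans (bs y)).
Qed.

Section Compile.

Variables (K : nat) (prog : seq instr).
Hypothesis K_gt1 : 1 < K.
Local Notation reaches := (reaches K prog).

Definition store_at l s c := exists f, config_at c (4 * l) f 0 /\ tape_of K f s.

Lemma step_ok pc c s i l v : code_at prog pc (i :: l) -> instr_valid K i ->
  inext i pc s <= (size prog).+1 -> rbound v s -> store_at pc s c ->
  reaches c (2 * v + 3) (store_at (inext i pc s) (isem i s)).
Proof.
move=> /code_at_hd[ltpc ndef] vi lt bv [f [Ac rf]]; rewrite -ndef in vi *.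
apply: reachesW (_ : 2 * rg s (ireg (nth default_instr prog pc)) + 3 <= _) _.
  by have := bv (ireg (nth default_instr prog pc)); lia.
have [m [lem [f' [Am rf']]]] := instr_ok ltpc vi Ac rf.
exists m; split=> //; exists f'; split=> //.
by rewrite ndef (minn_idPl lt) in Am *.
Qed.

Lemma goto_ok pc c s l' l v : code_at prog pc (goto l' :: l) ->
  l' <= (size prog).+1 -> rbound v s -> store_at pc s c ->
  reaches c (2 * v + 3) (store_at l' s).
Proof.
move=> ca le bv Ac.
have nx : inext (goto l') pc s = l' by rewrite /= ltnn.
by have := step_ok ca _ _ bv Ac; rewrite nx; apply => //; rewrite /= /rtrack K_gt1.
Qed.

Lemma leq_cost a n1 n2 v : n1 <= n2 -> a <= v ->
  n1 * (2 * a + 3) <= n2 * (2 * v + 3).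
Proof. by move=> *; apply: leq_mul; lia. Qed.

Lemma reaches_seq a n1 n2 m v c1 P Q :
  reaches c1 (n1 * (2 * a + 3)) P ->
  (forall c2, P c2 -> reaches c2 (n2 * (2 * v + 3)) Q) ->
  n1 + n2 <= m -> a <= v -> reaches c1 (m * (2 * v + 3)) Q.
Proof.
move=> H1 H2 len lea; apply: reachesW (reaches_trans H1 H2).
apply: leq_trans (_ : (n1 + n2) * (2 * v + 3) <= _).
  by rewrite mulnDl leq_add2r leq_mul2l leq_add2r leq_mul2l lea !orbT.
by rewrite leq_mul2r len orbT.
Qed.

Lemma reaches_one a c1 P :
  reaches c1 (2 * a + 3) P -> reaches c1 (1 * (2 * a + 3)) P.
Proof. by rewrite mul1n. Qed.

(** Each of the [n] instructions raises registers by at most one, so all values met are at most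
    [v + n] and each instruction takes at most [2 * (v + n) + 3] steps. The induction is on the
    execution, so that the remaining rounds of a loop are covered by a hypothesis at the same
    address. *)
Lemma compile_ok c s n s' : exec c s n s' -> forall b cf v,
  code_at prog b (compile b c) -> cmd_ok K c -> rbound v s -> store_at b s cf ->
  rbound (v + n) s' /\
  reaches cf (n * (2 * (v + n) + 3)) (store_at (b + size (compile b c)) s').
Proof.
elim=> {c s n s'}.
- by move=> s b cf v _ _ bv Ac; rewrite addn0; split=> //; exists 0; rewrite addn0.
- move=> p s b cf v ca vp bv Ac; rewrite !addn1; split; first exact: rbound_psem.
  have /= sz := code_at_size ca.
  have /= := step_ok ca vp _ bv Ac; rewrite addn1 in sz * => /(_ (leqW sz)).
  by apply: reachesW; lia.
- move=> c1 c2 s n1 s1 n2 s2 _ IH1 _ IH2 b cf v /= ca /andP[v1 v2] bv Ac.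
  have [bv1 R1] := IH1 _ _ _ (code_at_catl ca) v1 bv Ac.
  have H2 c' := IH2 _ c' _ (code_at_catr ca) v2 bv1.
  split.
    have [m [_ A1]] := R1.
    by have [] := H2 _ A1; rewrite addnA.
  rewrite size_cat addnA.
  apply: (reaches_seq (n2 := n2) R1) => //; last by lia.
  by move=> c' /H2[_]; rewrite addnA.
- move=> t c1 c2 s n s' ts _ IH b cf v /= ca /and3P[vt v1 v2] bv Ac.
  have sz := code_at_size ca; rewrite /= size_cat /= in sz.
  have ca1 : code_at prog b.+1 (compile b.+1 c1).
    by have := code_at_catl (code_at_catr (l := [:: _]) ca); rewrite addn1.
  have ca2 := code_at_catr (code_at_catr (l := [:: _]) ca); rewrite addn1 in ca2.
  have R0 : reaches cf (2 * v + 3) (store_at b.+1 s).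
    by have /= := step_ok ca vt _ bv Ac; rewrite ts; apply; lia.
  have [m [_ A1]] := R0.
  split.
    have [bv' _] := IH _ _ _ ca1 v1 bv A1.
    by move=> x; apply: leq_trans (bv' x) _; lia.
  rewrite size_cat /=.
  apply: (reaches_seq (n2 := n.+1) (reaches_one R0)) => //; last by lia.
  move=> c' A'; have [bv' R1] := IH _ _ _ ca1 v1 bv A'.
  apply: (reaches_seq (n2 := 1) R1); try lia.
  move=> c3 A3; apply: reaches_one.
  have := goto_ok ca2 _ _ A3 => /(_ (v + n.+2)).
  rewrite !addSn !addnS addnA; apply; first by lia.
  by move=> x; apply: leq_trans (bv' x) _; lia.
- move=> t c1 c2 s n s' ts _ IH b cf v /= ca /and3P[vt v1 v2] bv Ac.
  have sz := code_at_size ca; rewrite /= size_cat /= in sz.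
  have ca2 := code_at_catr (code_at_catr (l := [:: _]) ca).
  have {}ca2 := code_at_catr (l := [:: _]) ca2.
  rewrite /= addn1 addn1 addSn in ca2.
  have R0 : reaches cf (2 * v + 3) (store_at (b + size (compile b.+1 c1)).+2 s).
    by have /= := step_ok ca vt _ bv Ac; rewrite (negbTE ts); apply; lia.
  have [m [_ A1]] := R0.
  split.
    have [bv' _] := IH _ _ _ ca2 v2 bv A1.
    by move=> x; apply: leq_trans (bv' x) _; lia.
  rewrite size_cat /=.
  have -> l2 : b + (size (compile b.+1 c1) + l2.+1).+1 =
    (b + size (compile b.+1 c1)).+2 + l2 by lia.
  apply: (reaches_seq (n2 := n) (reaches_one R0)) => //; last by lia.
  move=> c' A'; have [bv' R1] := IH _ _ _ ca2 v2 bv A'.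
  by apply: reachesW R1; apply: leq_cost; lia.
- move=> t c s ts b cf v /= ca /andP[vt vc] bv Ac.
  have sz := code_at_size ca; rewrite /= size_cat /= in sz.
  split; first by move=> x; apply: leq_trans (bv x) _; lia.
  rewrite size_cat /=.
  have -> : b + (size (compile b.+1 c) + 1).+1 = (b + size (compile b.+1 c)).+2 by lia.
  have /= := step_ok ca vt _ bv Ac; rewrite (negbTE ts) => /(_ ltac:(lia)).
  by apply: reachesW; lia.
- move=> t c s n1 s1 n2 s2 ts _ IH1 _ IH2 b cf v ca /andP[vt vc] bv Ac.
  have ca' := ca; rewrite /= in ca'.
  have sz := code_at_size ca'; rewrite /= size_cat /= in sz.
  have ca1 : code_at prog b.+1 (compile b.+1 c).
    by have := code_at_catl (code_at_catr (l := [:: _]) ca'); rewrite addn1.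
  have ca2 := code_at_catr (code_at_catr (l := [:: _]) ca'); rewrite addn1 in ca2.
  have R0 : reaches cf (2 * v + 3) (store_at b.+1 s).
    by have /= := step_ok ca' vt _ bv Ac; rewrite ts; apply; lia.
  have body c' : store_at b.+1 s c' -> rbound (v + n1) s1 /\
      reaches c' ((n1 + 1) * (2 * (v + n1) + 3)) (store_at b s1).
    move=> A'; have [bv' R1] := IH1 _ _ _ ca1 vc bv A'; split=> //.
    apply: (reaches_seq (n2 := 1) R1); try lia.
    move=> c3 A3; apply: reaches_one; apply: goto_ok ca2 _ bv' A3; lia.
  have loop c' : rbound (v + n1) s1 -> store_at b s1 c' -> _ :=
    fun bv' A' => IH2 _ c' _ ca (introT andP (conj vt vc)) bv' A'.
  split.
    have [m1 [_ /body[bv' [m2 [_ A2]]]]] := R0.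
    have [bv'' _] := loop _ bv' A2.
    by move=> x; apply: leq_trans (bv'' x) _; lia.
  apply: (reaches_seq (n2 := (n1 + n2).+1) (reaches_one R0)); try lia.
  move=> c1 /body[bv' R1].
  apply: (reaches_seq (n2 := n2) R1); try lia.
  move=> c2 A2; have [_ R2] := loop _ bv' A2.
  by apply: reachesW R2; apply: leq_cost; lia.
Qed.

End Compile.

(** * Deciding by the final value of a register *)

Section Decide.

Variables (K : nat) (prg : cmd) (ok : nat).

(** Register 0 being zero, the final test falls through to the accepting address when register [ok]
    is positive, and otherwise jumps to the next address, which rejects. *)
Definition decider_code :=
  let l := compile 0 prg in l ++ [:: IJ (TLt 0 ok) (size l).+2].
Definition decider := machine K decider_code.

Definition istore x := Store (fun=> 0) (fun a i => if a == 0 then nth 0 x i else 0).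

Lemma decider_ok x n s N (Y : Prop) : 1 < K -> rtrack ok < K -> cmd_ok K prg ->
  all (fun a => a < 5) x -> 0 < size x ->
  exec prg (istore x) n s -> rg s 0 = 0 ->
  (0 < rg s ok <-> Y) -> 2 * n.+1 ^ 2 + 6 * n.+1 <= N ->
  let C := run decider N x in
  halted decider C /\ (cstate C = tm_accept decider <-> Y).
Proof.
move=> K1 vok vp x5 x0 ex s0 okY leN.
have szd : size decider_code = (size (compile 0 prg)).+1.
  by rewrite size_cat /= addn1.
have A1 : store_at K 0 (istore x) (step decider (init_config decider x)).
  exists (fun i => if i is i'.+1 then nth 0 x i' else 0); split; last first.
    split=> // k j ltj; rewrite /= dig_small; last first.
      case: (ltnP k (size x)) => [ltk|lek]; last by rewrite nth_default.
      by apply: (allP x5); rewrite mem_nth.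
    by rewrite /track /=; case: j {ltj} => [|[|j]] //=; case: ifP.
  case: x x0 {x5 ex} => // a x _; rewrite /step /halted /=.
  have -> : ((4 * size decider_code).+1 == 4 * size decider_code) = false by lia.
  have -> : ((4 * size decider_code).+1 == 4 * (size decider_code).+1) = false by lia.
  by rewrite /tm_trans eqxx.
have b0 : rbound 0 (istore x) by [].
have ca : code_at decider_code 0 (compile 0 prg).
  by exists [::], [:: IJ (TLt 0 ok) (size (compile 0 prg)).+2].
have [bn R1] := compile_ok K1 ex ca vp b0 A1; rewrite !add0n in bn R1.
have ca2 : code_at decider_code (size (compile 0 prg))
    [:: IJ (TLt 0 ok) (size (compile 0 prg)).+2].
  by exists (compile 0 prg), [::]; rewrite cats0.
have R2 c : store_at K (size (compile 0 prg)) s c ->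
    reaches K decider_code c (2 * n + 3)
      (store_at K (if 0 < rg s ok then size decider_code else (size decider_code).+1) s).
  move=> Ac; have /= := step_ok K1 ca2 _ _ bn Ac; rewrite s0 szd; apply.
    by rewrite K1.
  by case: ifP.
have [m [lem [f [[cs _ _ _] _]]]] := reaches_trans R1 R2.
set c1 := iter m _ _ in cs.
have h1 : halted decider c1.
  by rewrite /halted cs; case: ifP; rewrite eqxx ?orbT.
have -> : run decider N x = c1.
  (* One start step, [n * (2 * n + 3)] steps for the program and [2 * n + 3] for the final test. *)
  have lemN : m.+1 <= N.
    by move: lem leN; rewrite -mulnn; nia.
  rewrite /run -(subnK lemN) iterD iterSr -/c1.
  elim: (N - m.+1) => //= k ->; by rewrite /step h1.
split=> //; apply: iff_trans okY; rewrite cs /= szd.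
by case: ifP => _; split=> //; lia.
Qed.

End Decide.

(** * Macros and their total correctness within a time bound *)

Lemma store_ext s s' : rg s =1 rg s' -> ar s =2 ar s' -> s = s'.
Proof.
case: s s' => [r a] [r' a'] /= er ea; congr Store.
  exact: functional_extensionality.
by apply: functional_extensionality => x; apply: functional_extensionality => y.
Qed.

Lemma setr_setr x u v s : setr x v (setr x u s) = setr x v s.
Proof. by apply: store_ext => //= y; case: eqP. Qed.

Lemma setrC x y u v s : x != y -> setr x v (setr y u s) = setr y u (setr x v s).
Proof.
by move=> nxy; apply: store_ext => //= z; case: eqP => [->|//]; rewrite (negbTE nxy).
Qed.

Lemma setr_id x v s : rg s x = v -> setr x v s = s.
Proof. by move=> <-; apply: store_ext => //= y; case: eqP => [->|]. Qed.

Lemma seta_setr x v a i d s : seta a i d (setr x v s) = setr x v (seta a i d s).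
Proof. by []. Qed.

(** [Q ^ deg c] bounds the number of instructions when every loop makes at most [Q] rounds. The 2
    for a loop comes from [Q * (Q ^ d + 2) + 1 <= Q ^ (d + 2)], which for [d = 0] holds exactly from
    [Q = 4] on; hence [Q] has the form [q.+4]. *)
Fixpoint deg c :=
  match c with
  | Skip | Prim _ => 0
  | Seq c1 c2 | If _ c1 c2 => (maxn (deg c1) (deg c2)).+1
  | While _ c => (deg c).+2
  end.

Declare Scope cmd_scope.
Delimit Scope cmd_scope with cmd.
Bind Scope cmd_scope with cmd.
Notation "c1 ;; c2" := (Seq c1 c2) (at level 61, right associativity) : cmd_scope.
Local Open Scope cmd_scope.

Definition Inc x := Prim (PInc x).
Definition Clr x := Prim (PClr x).

(* Registers 0 to 5: the constant zero, the truth value of the last formula, the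
   last array index, two loop counters, and the row length of all arrays. *)
Local Notation rFL := 1 (only parsing).
Local Notation rZ := 2 (only parsing).
Local Notation rT1 := 3 (only parsing).
Local Notation rT2 := 4 (only parsing).
Local Notation rW := 5 (only parsing).

Definition For i y c := Clr i ;; While (TLt i y) (c ;; Inc i) ;; Clr i.
(** Arrays are stored by rows of length [rW]; the index of row [x], column [y] is obtained by
    counting, there being no multiplication. *)
Definition Idx x y := For rT1 x (For rT2 rW (Inc rZ)) ;; For rT2 y (Inc rZ).
Definition WriteF a x y d := Idx x y ;; Prim (PWr a rZ d) ;; Clr rZ.

Inductive formula :=
  | FArr of nat & nat & nat & nat
  | FLt of nat & nat
  | FNot of formula
  | FAnd of formula & formula
  | FEx of nat & nat & formula.

Fixpoint eval_cmd f : cmd :=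
  match f with
  | FArr a x y d =>
      Idx x y ;; Clr rFL ;; If (TArr a rZ d) (Inc rFL) Skip ;; Clr rZ
  | FLt x y => Clr rFL ;; If (TLt x y) (Inc rFL) Skip
  | FNot f => eval_cmd f ;; If (TLt 0 rFL) (Clr rFL) (Inc rFL)
  | FAnd f g => eval_cmd f ;; If (TLt 0 rFL) (eval_cmd g) Skip
  (* A witness makes the loop stop at once, before [rFL] is overwritten. *)
  | FEx i y f =>
      Clr i ;; Clr rFL ;;
      While (TLt i y)
        (eval_cmd f ;; If (TLt 0 rFL) (While (TLt i y) (Inc i)) (Inc i)) ;;
      Clr i
  end.

Fixpoint eval f s :=
  match f with
  | FArr a x y d => ar s a (rg s x * rg s rW + rg s y) == d
  | FLt x y => rg s x < rg s y
  | FNot f => ~~ eval f s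
  | FAnd f g => eval f s && eval g s
  | FEx i y f => has (fun v => eval f (setr i v s)) (iota 0 (rg s y))
  end.

Definition IfF f c1 c2 :=
  eval_cmd f ;; If (TLt 0 rFL) (Clr rFL ;; c1) (Clr rFL ;; c2).
Definition WhileF f c := eval_cmd f ;; While (TLt 0 rFL) (Clr rFL ;; c ;; eval_cmd f).

(** Registers 1 to 4 are scratch space of the macros. Register 0 may be named as the constant zero,
    which also serves as the row of a one-dimensional array. *)
Definition user x := (x == 0) || (4 < x).

Fixpoint bound_vars f :=
  match f with
  | FArr _ _ _ _ | FLt _ _ => [::]
  | FNot f => bound_vars f
  | FAnd f g => bound_vars f ++ bound_vars g
  | FEx i _ f => i :: bound_vars f
  end.

(** Evaluating a quantifier overwrites its register and finally clears it, so this register must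
    differ from the row length, from its own limit and from those bound inside. *)
Fixpoint formula_ok f :=
  match f with
  | FArr _ x y _ | FLt x y => user x && user y
  | FNot f => formula_ok f
  | FAnd f g => formula_ok f && formula_ok g
  | FEx i y f => [&& 5 < i, user y, i != y, i \notin bound_vars f & formula_ok f]
  end.

(** With bound registers zero beforehand, the final clear of each quantifier restores them, and
    evaluation changes the truth value only. *)
Definition fresh f s := all (fun i => rg s i == 0) (bound_vars f).

Lemma eq_eval f s s' : formula_ok f -> (forall x, user x -> rg s x = rg s' x) ->
  ar s = ar s' -> eval f s = eval f s'.
Proof.
elim: f s s' => [a x y d|x y|f IH|f IHf g IHg|i y f IH] s s' /=.
- by case/andP=> ux uy er ->; rewrite !er.
- by case/andP=> ux uy er _; rewrite !er.
- by move=> vf er ea; rewrite (IH s s').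
- by case/andP=> vf vg er ea; rewrite (IHf s s') // (IHg s s').
- case/and5P=> _ uy _ _ vf er ea; rewrite er //; apply: eq_has => v.
  by apply: IH => //= x /er ->.
Qed.

(** * Total correctness with a cost bound read off the syntax *)

Section Cost.

Variable q : nat.
Local Notation Q := q.+4.

Definition wp c s (P : store -> Prop) :=
  exists m s', [/\ m <= Q ^ deg c, exec c s m s' & P s'].

Lemma wpW c s (P R : store -> Prop) : (forall s', P s' -> R s') -> wp c s P -> wp c s R.
Proof. by move=> PR [m [s' [lem ex Ps]]]; exists m, s'; split=> //; apply: PR. Qed.

Lemma wp_skip s (P : store -> Prop) : P s -> wp Skip s P.
Proof. by exists 0, s; split=> //; constructor. Qed.

Lemma wp_prim p s (P : store -> Prop) : P (psem p s) -> wp (Prim p) s P.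
Proof. by exists 1, (psem p s); split=> //; constructor. Qed.

Lemma wp_inc x s (P : store -> Prop) : P (setr x (rg s x).+1 s) -> wp (Inc x) s P.
Proof. exact: wp_prim. Qed.

Lemma wp_clr x s (P : store -> Prop) : P (setr x 0 s) -> wp (Clr x) s P.
Proof. exact: wp_prim. Qed.

Let expQ_gt0 n : 0 < Q ^ n.
Proof. by rewrite expn_gt0. Qed.

Let leq_expQ m n : m <= n -> Q ^ m <= Q ^ n.
Proof. by move=> lemn; rewrite leq_pexp2l. Qed.

Lemma wp_seq c1 c2 s (P : store -> Prop) :
  wp c1 s (fun s1 => wp c2 s1 P) -> wp (c1 ;; c2) s P.
Proof.
case=> m1 [s1 [le1 ex1 [m2 [s2 [le2 ex2 Ps2]]]]].
exists (m1 + m2), s2; split=> //; last by apply: XSeq ex1 ex2.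
rewrite /= expnS.
have := leq_expQ (leq_maxl (deg c1) (deg c2)).
have := leq_expQ (leq_maxr (deg c1) (deg c2)).
nia.
Qed.

Lemma wp_if t c1 c2 s (P : store -> Prop) :
  wp (if tsem t s then c1 else c2) s P -> wp (If t c1 c2) s P.
Proof.
have le1 := leq_expQ (leq_maxl (deg c1) (deg c2)).
have le2 := leq_expQ (leq_maxr (deg c1) (deg c2)).
have gt0 := expQ_gt0 (maxn (deg c1) (deg c2)).
case: ifP => ts [m [s' [le ex Ps]]].
  by exists m.+2, s'; split=> //; [rewrite /= expnS; nia | apply: XIfT].
by exists m.+1, s'; split=> //; [rewrite /= expnS; nia | apply: XIfF => //; rewrite ts].
Qed.

(** The index of [Inv] counts completed rounds; that a true test forces [j < k] gives both
    termination and the cost. *)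
Lemma wp_while t c s (P : store -> Prop) (Inv : nat -> store -> Prop) k :
  k <= Q -> Inv 0 s ->
  (forall j s', Inv j s' -> tsem t s' -> j < k /\ wp c s' (Inv j.+1)) ->
  (forall j s', j <= k -> Inv j s' -> ~~ tsem t s' -> P s') ->
  wp (While t c) s P.
Proof.
move=> lek I0 Istep Pend.
have loop n j s0 : j + n = k -> Inv j s0 -> exists m s',
    [/\ m <= n * (Q ^ deg c + 2) + 1, exec (While t c) s0 m s' & P s'].
  elim: n j s0 => [|n IH] j s0 def_k Ij.
    case ts: (tsem t s0); first by have [] := Istep _ _ Ij ts; lia.
    exists 1, s0; split=> //; first by constructor; rewrite ts.
    by apply: (Pend j) => //; rewrite ?ts; lia.
  case ts: (tsem t s0); last first.
    exists 1, s0; split; first by lia.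
      by constructor; rewrite ts.
    by apply: (Pend j) => //; rewrite ?ts; lia.
  have [_ [m1 [s1 [le1 ex1 I1]]]] := Istep _ _ Ij ts.
  have [|m2 [s2 [le2 ex2 Ps2]]] := IH _ _ _ I1; first by lia.
  exists (m1 + m2).+2, s2; split=> //; first by rewrite mulSn; lia.
  exact: XWhileT ex2.
have [|m [s' [lem ex Ps]]] := loop k 0 s _ I0; first by [].
exists m, s'; split=> //=; rewrite !expnS.
have gt0 := expQ_gt0 (deg c).
apply: leq_trans lem _.
apply: (@leq_trans (Q * (Q ^ deg c + 2) + 1)); last by nia.
by rewrite leq_add2r leq_mul2r lek orbT.
Qed.

(** [Inv] speaks of the store with the loop register reset to zero, so counters need not appear in
    invariants; the body starts from [setr i j s']. *)
Lemma wp_for i y c s (P : store -> Prop) (Inv : nat -> store -> Prop) n :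
  i != y -> rg s i = 0 -> rg s y = n -> n <= Q -> Inv 0 s ->
  (forall j s', j < n -> Inv j s' -> rg s' i = 0 -> rg s' y = n ->
     wp c (setr i j s') (fun s2 =>
       [/\ rg s2 i = j, rg s2 y = n & Inv j.+1 (setr i 0 s2)])) ->
  (forall s', Inv n s' -> rg s' i = 0 -> rg s' y = n -> P s') ->
  wp (For i y c) s P.
Proof.
move=> niy si sy leQ I0 Istep Pend.
have nyi : (y == i) = false by rewrite eq_sym (negbTE niy).
apply/wp_seq/wp_clr; rewrite setr_id //; apply: wp_seq.
apply: (wp_while (k := n)
  (Inv := fun j s' => [/\ rg s' i = j, rg s' y = n & Inv j (setr i 0 s')])) => //.
- by split; rewrite // setr_id.
- move=> j s' [s'i s'y Ij] /=; rewrite s'i s'y => ltj; split=> //.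
  apply: wp_seq; have := Istep j _ ltj Ij; rewrite /= eqxx nyi => /(_ erefl s'y).
  rewrite setr_setr setr_id //; apply: wpW => s2 [s2i s2y I2].
  by apply: wp_inc; split; rewrite /= ?eqxx ?nyi ?s2i ?setr_setr.
- move=> j s' lej [s'i s'y Ij] /=; rewrite s'i s'y => gej; apply: wp_clr.
  have def_j : j = n by lia.
  by rewrite def_j in Ij; apply: Pend; rewrite //= ?eqxx ?nyi.
Qed.

(* Reserved registers other than the truth value are zero between commands. *)
Definition ready s := (forall x, x < 5 -> x != rFL -> rg s x = 0) /\ (forall x, rg s x <= Q).

Lemma readyP s : ready s -> [/\ rg s 0 = 0, rg s rZ = 0, rg s rT1 = 0 & rg s rT2 = 0].
Proof. by case=> s0 _; split; apply: s0. Qed.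

Lemma ready_setr x v s : (4 < x) || (x == rFL) -> v <= Q -> ready s -> ready (setr x v s).
Proof.
move=> ux lev [s0 sQ]; split=> y /=; last by case: eqP.
by case: (y =P x) => [def_y|_] lt5 n1; [move: ux n1; rewrite def_y; lia | apply: s0].
Qed.

Lemma wp_idx x y s (P : store -> Prop) : ready s -> user x -> user y ->
  P (setr rZ (rg s x * rg s rW + rg s y) s) -> wp (Idx x y) s P.
Proof.
move=> rs ux uy Ps; have [s0 sz s1 s2] := readyP rs; have sQ := rs.2.
have nu k u : user u -> 0 < k < 5 -> (u == k) = false by rewrite /user; lia.
apply: wp_seq.
apply: (wp_for (n := rg s x) (Inv := fun j s' => s' = setr rZ (j * rg s rW) s)) => //.
- by rewrite eq_sym nu.
- by rewrite setr_id.
- move=> j s' ltj -> _ _.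
  apply: (wp_for (n := rg s rW)
    (Inv := fun k s' => s' = setr rZ (j * rg s rW + k) (setr rT1 j s))) => //.
  + by rewrite addn0 setrC.
  + move=> k s'' ltk -> _ _; apply: wp_inc; split=> //=.
    rewrite setrC // setr_setr [setr 4 0 _]setrC // setr_setr addnS; congr setr.
    by rewrite setr_id //= s2.
  + move=> s'' -> _ _; split=> //=; first by rewrite !nu.
    by rewrite setrC // setr_setr [setr 3 0 s]setr_id // mulSn addnC.
- move=> s' -> _ _.
  apply: (wp_for (n := rg s y)
    (Inv := fun k s' => s' = setr rZ (rg s x * rg s rW + k) s)) => //.
  + by rewrite eq_sym nu.
  + by rewrite /= nu.
  + by rewrite addn0.
  + move=> k s'' ltk -> _ _; apply: wp_inc; split=> //=; first by rewrite !nu.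
    by rewrite setrC // setr_setr [setr 4 0 _]setrC // setr_setr addnS [setr 4 0 s]setr_id.
  + by move=> s'' ->.
Qed.

Lemma eval_setFL f v s : formula_ok f -> eval f (setr rFL v s) = eval f s.
Proof.
by move=> vf; apply: eq_eval => // x; rewrite /user /=; case: (x =P 1) => // ->.
Qed.

Lemma fresh_setr f x v s : x \notin bound_vars f -> fresh f s -> fresh f (setr x v s).
Proof.
move=> nx /allP fr; apply/allP => i ib /=; case: (i =P x) => [def_i|_]; last exact: fr.
by rewrite -def_i ib in nx.
Qed.

Lemma bvs_gt5 f i : formula_ok f -> i \in bound_vars f -> 5 < i.
Proof.
elim: f => //= [f IHf g IHg|j y f IH].
  by case/andP=> vf vg; rewrite mem_cat => /orP[/IHf|/IHg]; apply.
by case/and5P=> ltj _ _ _ vf; rewrite inE => /predU1P[->//|/IH]; apply.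
Qed.

Lemma wp_eval_cmd f s (P : store -> Prop) : ready s -> formula_ok f -> fresh f s ->
  P (setr rFL (eval f s) s) -> wp (eval_cmd f) s P.
Proof.
elim: f s P => [a x y d|x y|f IH|f IHf g IHg|i y f IH] s P rs vf fr Ps;
  have [s0 sz s1 s2] := readyP rs.
- case/andP: vf => ux uy; apply/wp_seq/wp_idx => //.
  apply/wp_seq/wp_clr/wp_seq/wp_if => /=; move: Ps => /=.
  have E v : setr rZ 0 (setr rFL v (setr rZ (rg s x * rg s rW + rg s y) s)) = setr rFL v s.
    by rewrite setrC // setr_setr [setr 2 0 s]setr_id.
  case: ifP => _ Ps; [apply: wp_inc|apply: wp_skip]; apply: wp_clr.
    by rewrite /= setr_setr E.
  by rewrite E.
- case/andP: vf => ux uy; apply/wp_seq/wp_clr/wp_if; move: Ps => /=.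
  have nu u : user u -> (u == 1) = false by rewrite /user; lia.
  rewrite !nu //; case: ifP => _ Ps; [apply: wp_inc|apply: wp_skip] => //.
  by rewrite /= setr_setr.
- apply/wp_seq/IH => //; apply: wp_if; rewrite /= s0; move: Ps => /=.
  case: eval => /= Ps; [apply: wp_clr|apply: wp_inc]; by rewrite /= setr_setr.
- case/andP: vf => vf vg; move: fr; rewrite /fresh all_cat => /andP[ff fg].
  apply/wp_seq/IHf => //; apply: wp_if; rewrite /= s0; move: Ps => /=.
  case: eval => /= Ps; last exact: wp_skip.
  apply: IHg => //; first by apply: ready_setr => //; lia.
    by apply: fresh_setr => //; apply/negP => /(bvs_gt5 vg).
  by rewrite eval_setFL // setr_setr.
- case/and5P: vf => lti uy niy nib vf; case/andP: fr => /eqP si ff.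
  have sQ := rs.2.
  have yi : (y == i) = false by rewrite eq_sym (negbTE niy).
  have y1 : (y == 1) = false by move: uy; rewrite /user; lia.
  have i1 : (i == 1) = false by lia.
  have i0 : (0 == i) = false by lia.
  pose ex j := has (fun v => eval f (setr i v s)) (iota 0 j).
  apply/wp_seq/wp_clr/wp_seq/wp_clr/wp_seq; rewrite [setr i 0 s]setr_id //.
  (* Either the answer is settled and register [i] already equals its limit, which ends the loop, or
     no witness lies below [j]. *)
  apply: (wp_while (k := rg s y) (Inv := fun j s' =>
    s' = setr rFL (ex (rg s y)) (setr i (rg s y) s) \/
    (j <= rg s y /\ ~~ ex j /\ s' = setr rFL 0 (setr i j s)))) => //.
  + by right; split=> //; split=> //; rewrite [setr i 0 s]setr_id.
  + move=> j s' [->|[lej [nex ->]]] /=; rewrite ?eqxx ?i1 ?yi ?y1 ?ltnn // => ltj.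
    split=> //; apply/wp_seq/IH => //.
    * do 2!apply: ready_setr => //; rewrite ?eqxx ?orbT ?(ltnW lti) //.
      by apply: leq_trans (sQ y); apply: ltnW.
    * apply: fresh_setr; first by apply/negP => /(bvs_gt5 vf).
      exact: fresh_setr.
    rewrite eval_setFL // setr_setr; apply: wp_if; rewrite /= i0 s0.
    have exS : ex j.+1 = eval f (setr i j s).
      by rewrite /ex -addn1 iotaD has_cat -/(ex j) (negbTE nex) /= orbF.
    case ef: (eval f _) => /=; last first.
      apply: wp_inc; right; split=> //; split; first by rewrite exS ef.
      by rewrite /= i1 eqxx setrC ?setr_setr // i1.
    have exT : ex (rg s y).
      have /hasP[v vj fv] : ex j.+1 by rewrite exS.
      apply/hasP; exists v => //; move: vj; rewrite !mem_iota; lia.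
    apply: (wp_while (k := rg s y - j)
      (Inv := fun k s' => j + k <= rg s y /\ s' = setr rFL 1 (setr i (j + k) s))).
    * by apply: leq_trans (sQ y); lia.
    * by rewrite addn0; split=> //; lia.
    * move=> k s3 [lek ->] /=; rewrite ?eqxx ?i1 ?yi ?y1 => ltk.
      split; first by lia.
      apply: wp_inc; split; first by lia.
      by rewrite /= i1 eqxx setrC ?setr_setr ?i1 // addnS.
    * move=> k s3 _ [lek ->] /=; rewrite ?eqxx ?i1 ?yi ?y1 => gek.
      by left; rewrite exT; have -> : j + k = rg s y by lia.
  + move=> j s' lej [->|[lej' [nex ->]]] /=; rewrite ?eqxx ?i1 ?yi ?y1 => gej; apply: wp_clr.
      by rewrite setrC ?i1 // setr_setr [setr i 0 s]setr_id.
    have def_j : j = rg s y by lia.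
    rewrite setrC ?i1 // setr_setr [setr i 0 s]setr_id //.
    by move: Ps => /=; rewrite -/(ex (rg s y)) -def_j (negbTE nex).
Qed.

End Cost.

(** * Reading the input *)

Local Notation rP := 6 (only parsing).

Definition parse_num x := Clr x ;; WhileF (FArr 0 0 rP 1) (Inc x ;; Inc rP) ;; Inc rP.
Definition parse_list body := Inc rP ;; WhileF (FNot (FArr 0 0 rP 4)) body ;; Inc rP.

Section Macros.

Variable q : nat.
Local Notation Q := q.+4.
Local Notation wp := (wp q).

Definition good s := ready q s /\ rg s 1 = 0.

Lemma wp_iff f c1 c2 s (P : store -> Prop) : good s -> formula_ok f -> fresh f s ->
  wp (if eval f s then c1 else c2) s P -> wp (IfF f c1 c2) s P.
Proof.
move=> [rs s1] vf fr wpc; have [s0 _ _ _] := readyP rs.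
apply/wp_seq/wp_eval_cmd => //; apply: wp_if => //=; rewrite s0.
by case: eval wpc => /= wpc; apply/wp_seq/wp_clr => //; rewrite setr_setr setr_id.
Qed.

Lemma wp_whilef f c s (P : store -> Prop) (Inv : nat -> store -> Prop) k :
  k <= Q -> formula_ok f -> Inv 0 s ->
  (forall j s', Inv j s' -> good s' /\ fresh f s') ->
  (forall j s', Inv j s' -> eval f s' -> j < k /\ wp c s' (Inv j.+1)) ->
  (forall j s', j <= k -> Inv j s' -> ~~ eval f s' -> P s') ->
  wp (WhileF f c) s P.
Proof.
move=> lek vf I0 Igood Istep Pend.
have [[rs s1] fr] := Igood _ _ I0.
apply/wp_seq/wp_eval_cmd => //.
apply: (wp_while (k := k)
  (Inv := fun j s' => exists2 s2, Inv j s2 & s' = setr rFL (eval f s2) s2)) => //.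
- by exists s.
- move=> j s' [s2 Ij ->] /=; have [[rs2 s21] fr2] := Igood _ _ Ij.
  have [-> _ _ _] := readyP rs2; case ef: eval => //= _.
  have [ltj wpc] := Istep _ _ Ij ef; split=> //.
  apply/wp_seq/wp_clr; rewrite setr_setr setr_id //; apply: wp_seq => //.
  apply: wpW wpc => s3 I3; have [[rs3 s31] fr3] := Igood _ _ I3.
  by apply: wp_eval_cmd => //; exists s3.
- move=> j s' lej [s2 Ij ->] /=; have [[rs2 s21] fr2] := Igood _ _ Ij.
  have [-> _ _ _] := readyP rs2; case ef: eval => //= _.
  by rewrite setr_id //; apply: Pend Ij _; rewrite ?ef.
Qed.

Lemma wp_write a x y d s (P : store -> Prop) : good s -> user x -> user y ->
  P (seta a (rg s x * rg s rW + rg s y) d s) -> wp (WriteF a x y d) s P.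
Proof.
move=> [rs s1] ux uy Ps; have [_ s2 _ _] := readyP rs.
apply/wp_seq/wp_idx => //; apply/wp_seq/wp_prim/wp_clr => //=.
by rewrite seta_setr setr_setr setr_id.
Qed.

Section Parse.

Variable inp : seq nat.
Hypothesis inpQ : size inp <= Q.

Definition reading p s := [/\ good s, ar s 0 = nth 0 inp & rg s rP = p].

Lemma reading_eval p s d : reading p s -> eval (FArr 0 0 rP d) s = (nth 0 inp p == d).
Proof. by case=> -[rs _] /= -> ->; have [-> _ _ _] := readyP rs. Qed.

Lemma good_setr x v s : 4 < x -> v <= Q -> good s -> good (setr x v s).
Proof.
move=> ltx lev [rs s1]; split; first by apply: ready_setr; rewrite ?ltx.
by rewrite /= ltn_eqF //; lia.
Qed.

Lemma wp_parse_num x v rest p s (P : store -> Prop) :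
  6 < x -> reading p s -> drop p inp = enc_nat v ++ rest ->
  (v < size inp -> p + v.+1 <= size inp -> drop (p + v.+1) inp = rest ->
     P (setr rP (p + v.+1) (setr x v s))) ->
  wp (parse_num x) s P.
Proof.
move=> ltx [gs a0 sp] dp Ps.
have x6 : (x == 6) = false by lia.
have szd : size inp - p = v.+1 + size rest.
  by rewrite -size_drop dp !size_cat size_nseq /=; lia.
have nthp j : nth 0 inp (p + j) = nth 0 (enc_nat v ++ rest) j by rewrite -dp nth_drop.
have setPx p' v' s' : setr rP p' (setr x v' s') = setr x v' (setr rP p' s').
  by rewrite setrC // eq_sym x6.
apply/wp_seq/wp_clr => //; apply: wp_seq => //.
pose S j := setr rP (p + j) (setr x j s).
have S0 : setr x 0 s = S 0 by rewrite /S setPx addn0 [setr rP p s]setr_id.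
have rS j : j <= v -> reading (p + j) (S j).
  move=> lej; split=> //.
  by apply: good_setr => //; last apply: good_setr => //; lia.
rewrite S0; apply: (wp_whilef (k := v)
  (Inv := fun j s' => j <= v /\ s' = S j)) => //.
- by lia.
- by move=> j _ [/rS[? _ _] ->].
- move=> j _ [lej ->].
  rewrite (reading_eval _ (rS j lej)) nthp -catA nth_cat size_nseq nth_nseq.
  case: ltnP => ltj; last by have -> : j - v = 0 by lia.
  move=> _; split=> //; apply/wp_seq/wp_inc/wp_inc => //; split=> //=.
  by rewrite x6 eqxx [6 == x]eq_sym x6 /S !setPx !setr_setr addnS.
- move=> j _ _ [lej ->].
  rewrite (reading_eval _ (rS j lej)) nthp -catA nth_cat size_nseq nth_nseq.
  case: ltnP => // gej _; have -> : j = v by lia.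
  apply: wp_inc => //=; rewrite /S setr_setr -addnS; apply: Ps; [lia | lia |].
  rewrite addnC -drop_drop dp drop_cat size_cat size_nseq addn1 ltnn.
  by rewrite subnn drop0.
Qed.

(** The default 4 in the condition on [head] makes encoded items non-empty as well as
    distinguishable from a closing bracket. So the loop recognizes the end, and there are fewer
    items than input symbols, which bounds the rounds. *)
Lemma wp_parse_list (T : Type) (enc : T -> seq nat) xs rest p s body
    (P : store -> Prop) (Inv : seq T -> nat -> store -> Prop) :
  (forall y, head 4 (enc y) != 4) -> rg s rP = p ->
  drop p inp = enc_list enc xs ++ rest ->
  Inv [::] p.+1 (setr rP p.+1 s) ->
  (forall done p' s', p' <= size inp -> size done < size inp -> Inv done p' s' ->
     reading p' s') ->
  (forall done y rest p' s', size done < size inp -> Inv done p' s' ->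
     drop p' inp = enc y ++ rest ->
     wp body s' (fun s2 => exists2 p2, drop p2 inp = rest & Inv (rcons done y) p2 s2)) ->
  (forall p' s', size xs < size inp -> p' < size inp -> drop p'.+1 inp = rest -> Inv xs p' s' ->
     P (setr rP p'.+1 s')) ->
  wp (parse_list body) s P.
Proof.
move=> enc4 sp dp I0 Iread Istep Pend.
have enc_gt0 y : 0 < size (enc y) by case: (enc y) (enc4 y).
have szxs : size xs < size inp.
  have := size_drop p inp; rewrite dp !size_cat /=.
  suff : size xs <= size (flatten (map enc xs)) by lia.
  by elim: (xs) => //= y ys; rewrite size_cat; have := enc_gt0 y; lia.
have ltdone done todo : xs = done ++ todo -> size done < size inp.
  by move=> def_xs; apply: leq_trans szxs; rewrite def_xs size_cat ltnS leq_addr.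
apply/wp_seq/wp_inc; rewrite sp; apply: wp_seq.
pose J j s' := exists done todo p', [/\ xs = done ++ todo, size done = j,
  drop p' inp = flatten (map enc todo) ++ 4 :: rest & Inv done p' s'].
have leJ p' l : drop p' inp = l ++ 4 :: rest -> p' <= size inp.
  by move/(congr1 size); rewrite size_drop size_cat /=; lia.
have nthJ p' : nth 0 inp p' = head 0 (drop p' inp) by rewrite -nth0 nth_drop addn0.
apply: (wp_whilef (k := size xs) (Inv := J)) => //; first by lia.
- exists [::], xs, p.+1; split=> //.
  by rewrite -add1n -drop_drop dp /= drop0 -catA.
- move=> j s' [done [todo [p' [def_xs _ /leJ lep I']]]].
  by have [] := Iread _ _ _ lep (ltdone _ _ def_xs) I'; split.
- move=> j s' [done [todo [p' [def_xs <- dp' I']]]].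
  rewrite [eval _ _]/= -/(eval (FArr 0 0 rP 4) s')
    (reading_eval _ (Iread _ _ _ (leJ _ _ dp') (ltdone _ _ def_xs) I')) nthJ dp'.
  case: todo def_xs dp' => [|y todo] //= def_xs dp'.
  move=> _; have lt : size done < size xs by rewrite def_xs size_cat /=; lia.
  split=> //; rewrite -catA in dp'.
  apply: wpW (Istep _ y _ _ _ _ I' dp') => [s2 [p2 dp2 I2]|]; last by lia.
  exists (rcons done y), todo, p2; split; rewrite ?size_rcons //.
  by rewrite cat_rcons.
- move=> j s' _ [done [todo [p' [def_xs szd dp' I']]]].
  rewrite [eval _ _]/= -/(eval (FArr 0 0 rP 4) s').
  have rd := Iread _ _ _ (leJ _ _ dp') (ltdone _ _ def_xs) I'.
  rewrite (reading_eval _ rd) nthJ dp'.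
  case: todo def_xs dp' => [|y todo] /= def_xs dp'.
    move=> _; apply: wp_inc; have [_ _ ->] := rd; apply: Pend => //.
    - by have := size_drop p' inp; rewrite dp' /=; lia.
    - by rewrite -add1n -drop_drop dp' /= drop0.
    - by rewrite def_xs cats0.
  by case: (enc y) (enc4 y) => //= z l /negbTE ->.
Qed.

End Parse.

End Macros.

(** * The steps of the program for one action of the plan *)

(* Registers: the last two numbers read ([rX], [rY]), the numbers of actions, of
   tasks and of rows ([rA], [rN], [rC]), the verdict [rOk], loop variables for
   propositions, tasks and rows ([rF], [rT], [rU], [rR], [rV]), the number [rO] of
   rows before the current step, and the flag [rB] for a task already matched. *)
Local Notation rX := 7 (only parsing).
Local Notation rY := 8 (only parsing).
Local Notation rA := 9 (only parsing).
Local Notation rN := 10 (only parsing).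
Local Notation rC := 11 (only parsing).
Local Notation rOk := 12 (only parsing).
Local Notation rF := 13 (only parsing).
Local Notation rT := 14 (only parsing).
Local Notation rU := 15 (only parsing).
Local Notation rR := 16 (only parsing).
Local Notation rO := 17 (only parsing).
Local Notation rV := 18 (only parsing).
Local Notation rB := 19 (only parsing).
Local Notation aPRE := 1 (only parsing).
Local Notation aDEL := 2 (only parsing).
Local Notation aADD := 3 (only parsing).
Local Notation aLAB := 4 (only parsing).
Local Notation aPRC := 5 (only parsing).
Local Notation aST := 6 (only parsing).
Local Notation aUSED := 7 (only parsing).
Local Notation aROW := 8 (only parsing).

(** Normal form of stores between commands: the reserved registers are zero and the list starts at
    register 5, so updates become [set_nth] on explicit lists. *)
Definition mk_store l a := Store (nth 0 [:: 0, 0, 0, 0, 0 & l]) (nth (fun=> 0) a).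

Lemma setr_mk x v l a : setr x.+4.+1 v (mk_store l a) = mk_store (set_nth 0 l x v) a.
Proof.
by apply: store_ext => // -[|[|[|[|[|y]]]]] //=; rewrite nth_set_nth.
Qed.

Lemma seta_mk b i d l a :
  seta b i d (mk_store l a) = mk_store l (set_nth (fun=> 0) a b (fupd (nth (fun=> 0) a b) i d)).
Proof.
apply: store_ext => // x y /=; rewrite nth_set_nth /= /fupd.
by case: eqP => [->|].
Qed.

Lemma good_mk q l a : all (fun v => v <= q.+4) l -> good q (mk_store l a).
Proof.
move=> /allP lq; split=> //; split=> [[|[|[|[|[|x]]]]] //|x /=].
case: x => [|[|[|[|[|x]]]]] //=; case: (ltnP x (size l)) => ltx.
  by apply: lq; rewrite mem_nth.
by rewrite nth_default.
Qed.

(** Propositions range below the input length, which exceeds their number. For each one the deletion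
    comes before the addition, so an added proposition survives. *)
Definition exec_step :=
  IfF (FEx rF rW (FAnd (FArr aPRE rX rF 1) (FNot (FArr aST 0 rF 1)))) (Clr rOk) Skip ;;
  For rF rW
    (IfF (FArr aDEL rX rF 1) (WriteF aST 0 rF 0) Skip ;;
     IfF (FArr aADD rX rF 1) (WriteF aST 0 rF 1) Skip).

Definition match_step :=
  For rT rN
    (IfF (FAnd (FNot (FLt 0 rB)) (FAnd (FArr aLAB rT rX 1) (FNot (FArr aUSED 0 rT 1))))
       (WriteF aUSED 0 rT 1 ;; Inc rB) Skip) ;;
  IfF (FLt 0 rB) Skip (Clr rOk) ;;
  Clr rB.

Definition FIff f g := FAnd (FNot (FAnd f (FNot g))) (FNot (FAnd (FNot f) g)).
Definition FAll i y f := FNot (FEx i y (FNot f)).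

(** The candidate is written into the first free row. Incrementing [rC] keeps it; if an earlier row
    is equal, [rC] stays and the next candidate overwrites it. *)
Definition extend_row :=
  For rU rN
    (IfF (FArr aROW rR rU 1) (WriteF aROW rC rU 1) (WriteF aROW rC rU 0)) ;;
  WriteF aROW rC rT 1 ;;
  IfF (FEx rV rC (FAll rU rN (FIff (FArr aROW rV rU 1) (FArr aROW rC rU 1))))
    Skip (Inc rC).

(** [rO] freezes the number of rows, so that one action never schedules two tasks. The old rows stay
    in the list, which covers the case that the action is left to an isolated task. *)
Definition row_step :=
  For rU rC (Inc rO) ;;
  For rR rO
    (For rT rN
      (IfF (FAnd (FArr aLAB rT rX 1)
             (FAnd (FNot (FArr aROW rR rT 1))
                   (FAll rU rN (FNot (FAnd (FArr aPRC rU rT 1)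
                                           (FNot (FArr aROW rR rU 1)))))))
         extend_row Skip)) ;;
  Clr rO.

Definition mat W (a : nat -> nat) (m : rel nat) :=
  forall r c, c < W -> a (r * W + c) = m r c.

Lemma idx_eq W r c r' c' : c < W -> c' < W ->
  (r * W + c == r' * W + c') = (r == r') && (c == c').
Proof.
move=> lt lt'; apply/eqP/andP => [e|[/eqP-> /eqP->]//].
have er : r = r'.
  have := congr1 (divn^~ W) e; rewrite !divnMDl ?divn_small ?addn0 //; lia.
by split; apply/eqP => //; move: e; rewrite er => /addnI.
Qed.

Lemma set_nth_nth (T : Type) (x0 : T) l i : i < size l -> set_nth x0 l i (nth x0 l i) = l.
Proof.
move=> lti; apply: (@eq_from_nth _ x0) => [|j _].
  by rewrite size_set_nth; apply/maxn_idPr.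
by rewrite nth_set_nth /=; case: eqP => [->|].
Qed.

Lemma wp_write_if q f a x y d l arr (P : store -> Prop) :
  all (fun v => v <= q.+4) l -> formula_ok f -> fresh f (mk_store l arr) -> user x -> user y ->
  a < size arr ->
  P (mk_store l (set_nth (fun=> 0) arr a (if eval f (mk_store l arr)
     then fupd (nth (fun=> 0) arr a)
            (rg (mk_store l arr) x * rg (mk_store l arr) 5 + rg (mk_store l arr) y) d
     else nth (fun=> 0) arr a))) ->
  wp q (IfF f (WriteF a x y d) Skip) (mk_store l arr) P.
Proof.
move=> /good_mk gs vf fr ux uy lta Ps; apply: wp_iff => //.
case: eval Ps => Ps; last by apply: wp_skip; rewrite set_nth_nth in Ps.
by apply: wp_write; rewrite ?seta_mk.
Qed.

(** * Task sets as rows of an array *)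

Section Rows.

Variables (W n : nat) (lab : nat -> nat) (prc : rel nat).

(* A row lists a set of tasks by its characteristic sequence; [can k X t] says that
   [t] has label [k] and may be scheduled once [X] has been. *)
Definition row (D : nat -> nat) r := mkseq (fun t => D (r * W + t) == 1) n.
Definition rows D c := [seq row D r | r <- iota 0 c].

Definition can (k : nat) (X : bitseq) t :=
  [&& lab t == k, ~~ nth false X t & all (fun u => prc u t ==> nth false X u) (iota 0 n)].
Definition ext (X : bitseq) t := set_nth false X t true.
Definition succ k (L : seq bitseq) X := exists Y t, [/\ Y \in L, t < n, can k Y t & X = ext Y t].

Lemma nth_row D r t : t < n -> nth false (row D r) t = (D (r * W + t) == 1).
Proof. by move=> ltt; rewrite nth_mkseq. Qed.

Lemma row_eq D r (X : bitseq) : size X = n ->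
  (forall t, t < n -> (D (r * W + t) == 1) = nth false X t) -> row D r = X.
Proof.
move=> sX e; apply: (@eq_from_nth _ false) => [|t]; rewrite size_mkseq // => ltt.
by rewrite nth_row ?e.
Qed.

Lemma eq_rows D D' c : (forall i, i < c -> row D' i = row D i) -> rows D' c = rows D c.
Proof. by move=> e; apply/eq_in_map => i; rewrite mem_iota => /e. Qed.

Lemma rowsS D c : rows D c.+1 = rcons (rows D c) (row D c).
Proof. by rewrite /rows -addn1 iotaD map_cat cats1. Qed.

Lemma size_rows D c : size (rows D c) = c.
Proof. by rewrite size_map size_iota. Qed.

End Rows.

(** * Correctness of the steps for one action *)

Section Program.

Variables (q W n : nat) (acts : seq action) (lab : nat -> nat) (prc : rel nat).
Local Notation Q := q.+4.
Local Notation wp := (wp q).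
Variables inp pre del add labA prcA : nat -> nat.
Hypotheses (WQ : W <= Q) (nW : n < W).
Local Notation act k := (nth (Action [::] [::] [::]) acts k).
Hypothesis preP : mat W pre (fun k f => f \in act_pre (act k)).
Hypothesis delP : mat W del (fun k f => f \in act_del (act k)).
Hypothesis addP : mat W add (fun k f => f \in act_add (act k)).
Hypothesis labP : forall t k, t < n -> k < W -> labA (t * W + k) = (lab t == k).
Hypothesis prcP : mat W prcA prc.

Definition plan_store (p x y A cnt : nat) (ok : bool) (F T U R old V fnd : nat)
    (S used D : nat -> nat) :=
  mk_store [:: W; p; x; y; A; n; cnt; nat_of_bool ok; F; T; U; R; old; V; fnd]
     [:: inp; pre; del; add; labA; prcA; S; used; D].

Lemma wp_exec_step p k y A cnt (ok : bool) (S used D : nat -> nat) (s : nat -> bool)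
    (P : store -> Prop) :
  p <= Q -> k < W -> y <= Q -> A <= Q -> cnt <= Q ->
  all (fun f => f < W) (act_pre (act k)) ->
  (forall f, f < W -> S f = s f) ->
  (forall S' : nat -> nat, (forall f, f < W -> S' f = apply_action (act k) s f) ->
    P (plan_store p k y A cnt (ok && all s (act_pre (act k))) 0 0 0 0 0 0 0 S' used D)) ->
  wp exec_step (plan_store p k y A cnt ok 0 0 0 0 0 0 0 S used D) P.
Proof.
move=> pQ kW yQ AQ cQ preW Ss Ps.
have g ok' F S' : F <= W ->
    good q (plan_store p k y A cnt ok' F 0 0 0 0 0 0 S' used D).
  by move=> *; apply: good_mk; rewrite /=; lia.
apply: wp_seq; apply: wp_iff => //; first exact: g.
set b := eval _ _.
have -> : b = ~~ all s (act_pre (act k)).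
  rewrite /b /=; apply/hasP/allPn => -[f].
    rewrite mem_iota /= => ltf; rewrite preP // Ss // !eqb1 => /andP[fp nsf].
    by exists f.
  move=> fp nsf; have ltf := allP preW _ fp; exists f; first by rewrite mem_iota.
  by rewrite preP // Ss // !eqb1 fp.
have {b} : wp (For rF rW
    (IfF (FArr aDEL rX rF 1) (WriteF aST 0 rF 0) Skip ;;
     IfF (FArr aADD rX rF 1) (WriteF aST 0 rF 1) Skip))
   (plan_store p k y A cnt (ok && all s (act_pre (act k))) 0 0 0 0 0 0 0 S used D) P.
  set ok' := ok && _.
  apply: (wp_for (n := W) (Inv := fun j s' => exists S' : nat -> nat,
    (forall f, f < W -> S' f = (if f < j then apply_action (act k) s f else s f)) /\
     s' = plan_store p k y A cnt ok' 0 0 0 0 0 0 0 S' used D)) => //.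
  - by exists S.
  - move=> j _ ltj [S' [S's ->]] _ _; rewrite setr_mk /=.
    apply/wp_seq/wp_write_if => //=; first by lia.
    rewrite delP // eqb1; apply: wp_write_if => //=; first by lia.
    rewrite addP // eqb1; split=> //; rewrite setr_mk /=; eexists; split; last by [].
    move=> f ltf; rewrite ltnS /fupd /apply_action.
    case addj: (j \in act_add _); case delj: (j \in act_del _);
      rewrite /= ?mul0n ?add0n ?nth0 /=; case: (ltngtP f j) => [ltfj|ltjf|->];
      rewrite ?S's ?ltfj ?ltnn ?addj ?delj ?orbT ?andbF //;
      rewrite ?ltnNge ?(ltnW ltjf) //=; by case: (s j).
  - move=> _ [S' [S's ->]] _ _; apply: Ps => f ltf; rewrite S's // ltf //.
move=> wpF; case: all wpF => /= wpF; first by apply: wp_skip; rewrite andbT in wpF.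
by apply: wp_clr; rewrite setr_mk /= andbF in wpF *.
Qed.

Lemma wp_match_step p k y A cnt (ok : bool) S used D (P : store -> Prop) :
  p <= Q -> k < W -> y <= Q -> A <= Q -> cnt <= Q ->
  let cand t := (lab t == k) && (used t != 1) in
  ((forall t, t < n -> ~~ cand t) -> P (plan_store p k y A cnt false 0 0 0 0 0 0 0 S used D)) ->
  (forall t, t < n -> cand t -> P (plan_store p k y A cnt ok 0 0 0 0 0 0 0 S (fupd used t 1) D)) ->
  wp match_step (plan_store p k y A cnt ok 0 0 0 0 0 0 0 S used D) P.
Proof.
move=> pQ kW yQ AQ cQ cand Pno Pyes.
apply: wp_seq.
apply: (wp_for (n := n) (Inv := fun j s' =>
    ((forall t, t < j -> ~~ cand t) /\ s' = plan_store p k y A cnt ok 0 0 0 0 0 0 0 S used D) \/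
    (exists2 t, t < n /\ cand t &
       s' = plan_store p k y A cnt ok 0 0 0 0 0 0 1 S (fupd used t 1) D))) => //; first by lia.
- by left.
- move=> j _ ltj [[nc ->]|[t tc ->]] _ _; rewrite setr_mk /=;
    (apply: wp_iff => //; first by apply: good_mk; rewrite /=; lia); rewrite /= ?labP //.
    rewrite eqb1 -/(cand j); case: ifP => cj; last first.
      apply: wp_skip; split=> //; rewrite setr_mk; left; split=> // t.
      by rewrite ltnS leq_eqVlt => /predU1P[->|/nc//]; rewrite cj.
    apply/wp_seq/wp_write => //; first by apply: good_mk; rewrite /=; lia.
    apply: wp_inc; rewrite seta_mk setr_mk; split=> //.
    by rewrite setr_mk /=; right; exists j.
  by apply: wp_skip; split=> //; rewrite setr_mk; right; exists t.
- move=> _ [[nc ->]|[t [ltt tc] ->]] _ _; apply/wp_seq/wp_iff => //=;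
    (try by apply: good_mk; rewrite /=; lia).
    by apply/wp_clr/wp_clr; rewrite !setr_mk /=; apply: Pno.
  by apply/wp_skip/wp_clr; rewrite !setr_mk /=; apply: Pyes.
Qed.

Local Notation row := (row W n).
Local Notation rows := (rows W n).

Lemma wp_extend_row p k y A c (ok : bool) t r old S used D (P : store -> Prop) :
  p <= Q -> k < W -> y <= Q -> A <= Q -> c < Q -> old <= Q -> t < n -> r < c ->
  (forall D', (forall i, i < c -> row D' i = row D i) ->
     row D' c = ext (row D r) t ->
     P (plan_store p k y A (if ext (row D r) t \in rows D c then c else c.+1)
            ok 0 t 0 r old 0 0 S used D')) ->
  wp extend_row (plan_store p k y A c ok 0 t 0 r old 0 0 S used D) P.
Proof.
move=> pQ kW yQ AQ cQ oQ ltt ltr Ps.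
apply: wp_seq.
apply: (wp_for (n := n) (Inv := fun j s' => exists D' : nat -> nat,
  [/\ forall i u, i < c -> u < n -> D' (i * W + u) = D (i * W + u),
       forall u, u < j -> (D' (c * W + u) == 1) = (D (r * W + u) == 1)
     & s' = plan_store p k y A c ok 0 t 0 r old 0 0 S used D'])) => //; first by lia.
  by exists D.
- move=> j _ ltj [D' [oldD newD ->]] _ _; rewrite setr_mk /=.
  apply: wp_iff => //=; first by apply: good_mk; rewrite /=; lia.
  have wr d : (d == 1) = (D (r * W + j) == 1) -> wp (WriteF 8 11 15 d)
    (mk_store [:: W; p; k; y; A; n; c; ok : nat; 0; t; j; r; old; 0; 0]
        [:: inp; pre; del; add; labA; prcA; S; used; D'])
    (fun s2 => [/\ rg s2 15 = j, rg s2 10 = n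
       & exists D' : nat -> nat,
     [/\ forall i u, i < c -> u < n -> D' (i * W + u) = D (i * W + u),
          forall u, u < j.+1 -> (D' (c * W + u) == 1) = (D (r * W + u) == 1)
        & setr 15 0 s2 = plan_store p k y A c ok 0 t 0 r old 0 0 S used D']]).
    move=> d1; apply: wp_write => //; first by apply: good_mk; rewrite /=; lia.
    rewrite seta_mk; split=> //=; eexists; split; last by rewrite setr_mk.
      move=> i u lti ltu; rewrite /= /fupd idx_eq ?oldD //; try lia.
      by rewrite ltn_eqF.
    move=> u leu; rewrite /= /fupd idx_eq; try lia.
    rewrite eqxx /=; case: (u =P j) => [->//|neu]; rewrite newD //; lia.
  by case: ifP; rewrite oldD // => e; apply: wr; rewrite e.
- move=> _ [D' [oldD newD ->]] _ _.
  apply/wp_seq/wp_write => //; first by apply: good_mk; rewrite /=; lia.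
  rewrite seta_mk /=; set D2 := fupd _ _ _.
  have old2 i : i < c -> row D2 i = row D i.
    move=> lti; apply: row_eq; rewrite ?size_mkseq // => u ltu.
    rewrite nth_row // /D2 /fupd idx_eq; try lia.
    by rewrite [i == c]ltn_eqF //= oldD.
  have new2 : row D2 c = ext (row D r) t.
    apply: row_eq => [|u ltu].
      by rewrite size_set_nth size_mkseq; apply/maxn_idPr.
    rewrite nth_set_nth /= nth_row // /D2 /fupd idx_eq; try lia.
    by rewrite eqxx /=; case: (u =P t) => // _; rewrite newD.
  apply: wp_iff => //=; first by apply: good_mk; rewrite /=; lia.
  set b := has _ _; have {b}-> : b = (ext (row D r) t \in rows D c).
    rewrite -(eq_rows old2) -new2; apply/hasP/mapP => -[i].
      rewrite mem_iota /= => lti /hasPn e; exists i; rewrite ?mem_iota //.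
      apply: row_eq => [|u ltu]; first by rewrite size_mkseq.
      have /= := e u; rewrite mem_iota ltu nth_row // => /(_ isT).
      by case: (_ == 1); case: (_ == 1).
    rewrite mem_iota /= => lti e; exists i; rewrite ?mem_iota //; apply/hasPn => u.
    rewrite mem_iota /= => ltu; have := congr1 (fun X => nth false X u) e.
    rewrite !nth_row // => ->.
    by case: (_ == 1).
  have := Ps _ old2 new2; case: ifP => _ PD2; first exact: wp_skip.
  by apply: wp_inc; rewrite setr_mk.
Qed.

Local Notation can := (can n lab prc).
Local Notation succ := (succ n lab prc).

(** The hypothesis on duplicate-free extensions of [L] by successors keeps every row count met
    during the step below [Q]; the width will enter through it alone. *)
Lemma wp_row_step p k y A c (ok : bool) S used D (P : store -> Prop) :
  p <= Q -> k < W -> y <= Q -> A <= Q ->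
  let L := rows D c in uniq L ->
  (forall M, uniq (L ++ M) -> (forall X, X \in M -> succ k L X) -> size (L ++ M) < Q) ->
  (forall D' M, rows D' (c + size M) = L ++ M -> uniq (L ++ M) ->
     (forall X, X \in M -> succ k L X) ->
     (forall Y t, Y \in L -> t < n -> can k Y t -> ext Y t \in L ++ M) ->
     P (plan_store p k y A (c + size M) ok 0 0 0 0 0 0 0 S used D')) ->
  wp row_step (plan_store p k y A c ok 0 0 0 0 0 0 0 S used D) P.
Proof.
move=> pQ kW yQ AQ L uL Lbd Ps.
have szL : size L = c by rewrite size_rows.
have cQ : c < Q by rewrite -szL -[L]cats0; apply: Lbd; rewrite ?cats0.
apply: wp_seq.
apply: (wp_for (n := c)
  (Inv := fun j s' => s' = plan_store p k y A c ok 0 0 0 0 j 0 0 S used D)) => //; first by lia.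
  move=> j _ ltj -> _ _; rewrite setr_mk; apply: wp_inc.
  by rewrite setr_mk; split=> //; rewrite setr_mk.
move=> _ -> _ _; apply: wp_seq.
(* All pairs of an old row and a task lexicographically before [(r, t)] have been tried. *)
pose I r t s' := exists D' M,
  [/\ rows D' (c + size M) = L ++ M, uniq (L ++ M),
      forall X, X \in M -> succ k L X,
      forall i u, (i < r) || (i == r) && (u < t) -> i < c -> u < n ->
        can k (row D i) u -> ext (row D i) u \in L ++ M
    & s' = plan_store p k y A (c + size M) ok 0 0 0 0 c 0 0 S used D'].
apply: (wp_for (n := c) (Inv := fun r => I r 0)) => //; first by lia.
- by exists D, [::]; rewrite cats0 addn0; split=> // i u; rewrite ltn0 andbF.
- move=> r _ ltr [D0 [M0 [rD0 uM0 sM0 cM0 ->]]] _ _; rewrite setr_mk /=.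
  apply: (wp_for (n := n) (Inv := fun t s' =>
    rg s' rR = r /\ I r t (setr rR 0 s'))) => //; first by lia.
  + by split; rewrite // setr_mk; exists D0, M0.
  + move=> t s1 ltt [s1r [D1 [M1 [rD1 uM1 sM1 cM1 def_s1]]]] s1t s1n.
    have {def_s1 s1r}-> : setr rT t s1 = plan_store p k y A (c + size M1) ok 0 t 0 r c 0 0 S used D1.
      have -> : s1 = setr rR r (setr rR 0 s1) by rewrite setr_setr setr_id.
      by rewrite def_s1 !setr_mk.
    have c1Q : c + size M1 < Q by rewrite -szL -size_cat; apply: Lbd.
    have rowD1 i : i < c -> row D1 i = row D i.
      move=> lti; have := congr1 (fun l => nth [::] l i) rD1.
      by rewrite nth_cat szL lti !(nth_map 0) ?size_iota ?nth_iota //; lia.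
    apply: wp_iff => //=; first by apply: good_mk; rewrite /=; lia.
    set b := _ && _; have {b}-> : b = can k (row D r) t.
      rewrite /b /can -(rowD1 r) // nth_row // labP // eqb1; congr [&& _, _ & _].
      rewrite -all_predC; apply: eq_in_all => u; rewrite mem_iota => /andP[_ ltu] /=.
      by rewrite prcP ?eqb1 ?nth_row ?negb_and ?negbK ?implybE //; lia.
    case: ifP => crt; last first.
      apply: wp_skip; split=> //; split=> //; exists D1, M1; split=> //.
        move=> i u lt_iu lti ltu can_u; apply: cM1 => //.
        have [/andP[/eqP def_i /eqP def_u]|] := boolP ((i == r) && (u == t)).
          by rewrite def_i def_u crt in can_u.
        by move: lt_iu; lia.
      by rewrite !setr_mk.
    apply: wp_extend_row => //; try lia.
    move=> D2 old2 new2; split=> //; split=> //.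
    have rD2 : rows D2 (c + size M1) = L ++ M1 by rewrite (eq_rows old2).
    rewrite (rowD1 r) // rD1; rewrite (rowD1 r) // in new2.
    have crit M i u : (i < r) || (i == r) && (u < t.+1) -> i < c -> u < n ->
        can k (row D i) u -> {subset L ++ M1 <= L ++ M} -> ext (row D r) t \in L ++ M ->
        ext (row D i) u \in L ++ M.
      move=> lt_iu lti ltu can_u sub1 new1.
      have [/andP[/eqP-> /eqP->]//|ne] := boolP ((i == r) && (u == t)).
      by apply/sub1/cM1 => //; move: lt_iu ne; lia.
    case: ifP => inX.
      exists D2, M1; split=> // [i u lt_iu lti ltu can_u|]; first exact: crit can_u _ _.
      by rewrite !setr_mk.
    exists D2, (rcons M1 (ext (row D r) t)); split.
    - by rewrite size_rcons addnS rowsS rD2 new2 rcons_cat.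
    - by rewrite -rcons_cat rcons_uniq inX.
    - move=> X; rewrite mem_rcons => /predU1P[->|/sM1//].
      exists (row D r), t; split=> //; apply/mapP; exists r => //.
      by rewrite mem_iota.
    - move=> i u lt_iu lti ltu can_u; apply: crit can_u _ _ => //.
        by move=> X; rewrite !mem_cat mem_rcons inE; case/orP => ->; rewrite ?orbT.
      by rewrite mem_cat mem_rcons inE eqxx orbT.
    - by rewrite !setr_mk size_rcons addnS.
  + move=> s1 [s1r [D1 [M1 [rD1 uM1 sM1 cM1 def_s1]]]] s1t s1n; split=> //.
      have -> : s1 = setr rR r (setr rR 0 s1) by rewrite setr_setr setr_id.
      by rewrite def_s1.
    exists D1, M1; split=> // i u; rewrite ltn0 andbF orbF ltnS leq_eqVlt => lt_iu lti ltu.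
    by apply: cM1 => //; rewrite ltu andbT orbC.
- move=> _ [D1 [M1 [rD1 uM1 sM1 cM1 ->]]] _ _; apply: wp_clr; rewrite setr_mk.
  apply: (Ps D1 M1) => // Y u /mapP[i]; rewrite mem_iota => /andP[_ lti] -> ltu.
  by apply: cM1 => //; rewrite lti.
Qed.

End Program.

(** * Linearizations and reachable rows *)

Lemma subseq_index (T : eqType) (s1 s2 : seq T) u t :
  subseq s1 s2 -> uniq s2 -> t \in s1 -> index u s1 < index t s1 ->
  index u s2 < index t s2.
Proof.
elim: s2 s1 => [|y s2 IH] [|x s1] //=.
case: (x =P y) => [->|_] s12 /andP[ny2 u2].
  rewrite inE [t == y]eq_sym; case: (y =P t) => //= _ t1; case: (y =P u) => // _.
  by rewrite !ltnS; apply: IH.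
move=> t1 lt_ut; have := IH _ s12 u2 t1 lt_ut.
have neq z : z \in x :: s1 -> (y == z) = false.
  by move=> /(mem_subseq s12) z2; apply: contraNF ny2 => /eqP->.
have u1 : u \in x :: s1 by rewrite -index_mem (leq_trans lt_ut (index_size t (x :: s1))).
by rewrite !neq.
Qed.

(* Positions of [p] not used by [ts] are filled greedily from the pool [U]. *)
Lemma fill_subseq (f : nat -> nat) p ts U :
  subseq (map f ts) p -> perm_eq p (map f (ts ++ U)) ->
  exists lin, [/\ map f lin = p, perm_eq lin (ts ++ U) & subseq ts lin].
Proof.
elim: p ts U => [|k p IH] ts U.
  by case: ts => // _ /perm_size; case: U => // _; exists [::].
have skip : subseq (map f ts) p -> perm_eq (k :: p) (map f (ts ++ U)) ->
    exists lin, [/\ map f lin = k :: p, perm_eq lin (ts ++ U) & subseq ts lin].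
  (* By counting [k]: the labels of [ts] contain it at most as often as the rest of the plan, so one
     occurrence is left for the pool. *)
  move=> sub pe; have : k \in map f U.
    rewrite -has_pred1 has_count; move/permP: pe => /(_ (pred1 k)).
    rewrite map_cat count_cat /= eqxx; have := leq_count_subseq (pred1 k) sub.
    set a := count_mem _ _; set b := count_mem _ _; set c := count_mem _ _.
    by clearbody a b c; lia.
  case/mapP => u Uu def_k.
  have peU : perm_eq (ts ++ U) (u :: ts ++ rem u U).
    by rewrite perm_sym -cat1s perm_catCA /= perm_cat2l perm_sym perm_to_rem.
  have [|lin [def_p pl sl]] := IH ts (rem u U) sub.
    by have := perm_trans pe (perm_map f peU); rewrite /= -def_k perm_cons.
  exists (u :: lin); split; first by rewrite /= def_p def_k.
    by rewrite (permPr peU) perm_cons.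
  exact: subseq_trans sl (subseq_cons _ _).
case: ts skip => [|t ts] skip //=; first by move=> _; apply: skip; apply: sub0seq.
case: eqP => [def_k|_]; last exact: skip.
rewrite -def_k perm_cons => sub pe; have [lin [def_p pl sl]] := IH _ _ sub pe.
by exists (t :: lin); rewrite /= def_p perm_cons eqxx.
Qed.

(** A set of at most [w] elements is the range of a partial function on ['I_w], and there are
    [#|T|.+1 ^ w] of these. *)
Lemma card_small_sets (T : finType) w : #|[set A : {set T} | #|A| <= w]| <= #|T|.+1 ^ w.
Proof.
rewrite -card_option -[X in _ ^ X]card_ord -card_ffun.
pose F (f : {ffun 'I_w -> option T}) := [set t | Some t \in codom f].
rewrite -cardsT; apply: leq_trans (leq_imset_card F _).
apply/subset_leq_card/subsetP => A; rewrite inE => leA; apply/imsetP.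
exists [ffun i : 'I_w => nth None (map Some (enum A)) i] => //.
apply/setP => t; rewrite inE; apply/idP/codomP => [tA|[i]].
  have lti : index t (enum A) < w by rewrite (leq_trans _ leA) // cardE index_mem mem_enum.
  by exists (Ordinal lti); rewrite ffunE (nth_map t) ?nth_index ?index_mem ?mem_enum.
rewrite ffunE; case: (ltnP i (size (enum A))) => lti; last first.
  by rewrite nth_default ?size_map.
by rewrite (nth_map t) // => -[->]; rewrite -mem_enum mem_nth.
Qed.

(** * Reachable sets, linearizations and the width *)

Section Instance.

Variable I : instance.
Hypothesis wfI : wf_instance I.
Local Notation n := (ntasks I).
Local Notation prc := (prec I).
Local Notation can := (can n (alpha I) prc).

Definition isolated t := ~~ has (fun tt => (tt.1 == t) || (tt.2 == t)) (inst_order I).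
Definition row0 := mkseq isolated n.

(* The prefix of the plan is given in reverse. *)
Fixpoint reach (rp : seq nat) (X : bitseq) : Prop :=
  if rp is k :: rp' then
    reach rp' X \/ exists Y t, [/\ reach rp' Y, t < n, can k Y t & X = ext Y t]
  else X = row0.

Lemma prec_lt u t : prc u t -> (u < n) && (t < n).
Proof. by have [_ [/allP h _ _]] := wfI => /h. Qed.

Lemma prec_iso u t : prc u t -> ~~ isolated u && ~~ isolated t.
Proof.
by move=> ut; rewrite !negbK; apply/andP; split; apply/hasP;
  exists (u, t); rewrite //= eqxx ?orbT.
Qed.

Lemma nth_row0 t : t < n -> nth false row0 t = isolated t.
Proof. by move=> ltt; rewrite nth_mkseq. Qed.

Lemma size_ext (X : bitseq) t : size X = n -> t < n -> size (ext X t) = n.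
Proof. by move=> sX ltt; rewrite size_set_nth sX; apply/maxn_idPr. Qed.

Lemma nth_ext (X : bitseq) t u : nth false (ext X t) u = (u == t) || nth false X u.
Proof. by rewrite nth_set_nth /=; case: eqP. Qed.

Lemma reach_size rp X : reach rp X -> size X = n.
Proof.
elim: rp X => [|k rp IH] X /= => [->|[/IH//|[Y [t [/IH sY ltt _ ->]]]]].
  by rewrite size_mkseq.
exact: size_ext.
Qed.

Lemma reach_iso rp X t : reach rp X -> t < n -> isolated t -> nth false X t.
Proof.
move=> + ltt iso_t; elim: rp X => [|k rp IH] X /= => [->|[/IH//|[Y [u [/IH tY _ _ ->]]]]].
  by rewrite nth_row0.
by rewrite nth_ext tY orbT.
Qed.

Lemma reach_down rp X u t : reach rp X -> prc u t -> nth false X t -> nth false X u.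
Proof.
move=> + ut; have /andP[ltu ltt] := prec_lt ut; have /andP[_ nt] := prec_iso ut.
elim: rp X => [|k rp IH] X /= => [->|[/IH//|[Y [v [/IH tY _ cYv ->]]]]].
  by rewrite nth_row0 // (negbTE nt).
rewrite !nth_ext => /orP[/eqP def_t|/tY ->]; last by rewrite orbT.
case/and3P: cYv => _ _ /allP/(_ u); rewrite mem_iota ltu -def_t ut => /(_ isT) /= ->.
by rewrite orbT.
Qed.

(** [ts] lists the scheduled tasks in the order of scheduling. A new task goes to the end, and [can]
    ensures that its predecessors, which are not isolated, are in [ts] already. The last clause
    includes this membership, since an absent element has index [size ts]. *)
Lemma reach_linear p X : reach (rev p) X -> exists ts,
  [/\ uniq ts, subseq (map (alpha I) ts) p, {in ts, forall t, t < n},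
      {in gtn n, forall t, nth false X t = isolated t || (t \in ts)}
    & {in ts, forall t u, prc u t -> index u ts < index t ts}].
Proof.
elim/last_ind: p X => [|p k IH] X; rewrite ?rev_rcons /=.
  by move=> ->; exists [::]; split=> // t ltt; rewrite orbF nth_row0.
case=> [/IH[ts [uts sub ltn Xts ord]]|[Y [t [/IH[ts [uts sub ltn Yts ord]] ltt cYt ->]]]].
  by exists ts; split=> //; apply: subseq_trans sub (subseq_rcons _ _).
case/and3P: cYt => /eqP def_k nYt /allP prY.
have nt : t \notin ts by move: nYt; rewrite Yts // negb_or => /andP[].
exists (rcons ts t); split.
- by rewrite rcons_uniq nt.
- by rewrite map_rcons def_k -!cats1 cat_subseq.
- by move=> u; rewrite mem_rcons => /predU1P[->|/ltn].
- by move=> u ltu; rewrite nth_ext Yts // mem_rcons inE orbCA.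
move=> u uts' v vu; rewrite -cats1 !index_cat.
have [in_u|nu] := boolP (u \in ts).
  have lt_vu := ord u in_u v vu.
  by rewrite -index_mem (leq_trans lt_vu) // index_size.
have def_u : u = t by move: uts'; rewrite mem_rcons inE (negbTE nu) orbF => /eqP.
have v_ts : v \in ts.
  have /andP[ltv _] := prec_lt vu; have /andP[/negbTE niv _] := prec_iso vu.
  by have := prY v; rewrite mem_iota ltv -def_u vu Yts // niv => /(_ isT).
rewrite v_ts.
by rewrite (leq_trans _ (leq_addr _ _)) ?index_mem.
Qed.

(** After [i] actions take the isolated tasks together with the first [i] tasks of the
    linearization: an isolated task leaves this set unchanged, any other one is scheduled. *)
Lemma linear_reach lin : perm_eq lin (iota 0 n) ->
  all (fun tt => index tt.1 lin < index tt.2 lin) (inst_order I) ->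
  reach (rev (map (alpha I) lin)) (nseq n true).
Proof.
move=> pl /allP ord.
have ul : uniq lin by rewrite (perm_uniq pl) iota_uniq.
have sl : size lin = n by rewrite (perm_size pl) size_iota.
have ml t : (t \in lin) = (t < n) by rewrite (perm_mem pl) mem_iota.
pose X i := mkseq (fun t => isolated t || (t \in take i lin)) n.
have tn : take n lin = lin by rewrite -sl take_size.
suff : reach (rev (map (alpha I) (take n lin))) (X n).
  rewrite tn; have -> // : X n = nseq n true.
  apply: (@eq_from_nth _ false) => [|t]; rewrite size_mkseq ?size_nseq // => ltt.
  by rewrite nth_nseq ltt nth_mkseq // tn ml ltt orbT.
elim: {-2}n (leqnn n) => [|i IH] lei.
  rewrite take0 /= /X /row0; apply/eq_in_map => t _.
  by rewrite take0 orbF.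
have lti : i < size lin by rewrite sl.
rewrite (take_nth 0) // map_rcons rev_rcons /=.
set t := nth 0 lin i.
have ltt : t < n by rewrite -ml mem_nth.
have XS u : u < n -> nth false (X i.+1) u = (u == t) || nth false (X i) u.
  by move=> ltu; rewrite !nth_mkseq // (take_nth 0) // mem_rcons inE orbCA.
have [iso_t|nt] := boolP (isolated t).
  left; have -> : X i.+1 = X i; last exact: IH (ltnW lei).
  apply: (@eq_from_nth _ false) => [|u]; rewrite !size_mkseq // => ltu.
  by rewrite XS //; case: eqP => // ->; rewrite nth_mkseq // iso_t.
right; exists (X i), t; split=> //; first exact: IH (ltnW lei).
  have idx_t : index t lin = i by rewrite index_uniq.
  apply/and3P; split; first by [].
    by rewrite nth_mkseq // (negbTE nt) in_take ?mem_nth // idx_t ltnn.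
  apply/allP => u; rewrite mem_iota => /andP[_ ltu]; apply/implyP => ut.
  rewrite nth_mkseq // in_take ?ml //.
  by have /= := ord _ ut; rewrite idx_t => ->; rewrite orbT.
apply: (@eq_from_nth _ false) => [|u]; rewrite size_mkseq.
  by rewrite size_ext ?size_mkseq.
by move=> ltu; rewrite XS // nth_ext.
Qed.

Lemma map_alpha_iota : map (alpha I) (iota 0 n) = inst_labels I.
Proof. exact: mkseq_nth. Qed.

(** Executability concerns the plan only. For the converse, reaching the full row means that all
    tasks outside [ts] are isolated; they fill the remaining positions by label, and the order
    relates only members of [ts], whose relative positions are kept. *)
Lemma PV_yesP : PV_yes I <->
  [/\ executable (fun f => f \in inst_init I) (map (action_of I) (inst_plan I)),
      perm_eq (inst_labels I) (inst_plan I)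
    & reach (rev (inst_plan I)) (nseq n true)].
Proof.
split=> [[lin [/andP[pl ord] <- ex]]|[ex pe re]].
  split=> //; last exact: linear_reach.
  by rewrite -map_alpha_iota perm_sym perm_map.
have [ts [uts sub ltn Xts ord]] := reach_linear re.
pose U := [seq t <- iota 0 n | t \notin ts].
have pU : perm_eq (ts ++ U) (iota 0 n).
  apply: uniq_perm; rewrite ?iota_uniq //.
    rewrite cat_uniq uts filter_uniq ?iota_uniq // andbT; apply/hasPn => t.
    by rewrite mem_filter => /andP[].
  move=> t; rewrite mem_cat mem_filter mem_iota /= add0n.
  by case: (boolP (t \in ts)) => // /ltn ->.
have [|lin [def_p pl sl]] := fill_subseq (U := U) sub.
  by rewrite perm_sym (permPl (perm_map _ pU)) map_alpha_iota.
have pl' := perm_trans pl pU.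
exists lin; split=> //; rewrite /is_linearization pl'; apply/allP => -[u t] ut /=.
have /andP[ltu ltt] := prec_lt ut; have /andP[nu nt] := prec_iso ut.
have tts : t \in ts by have := Xts t ltt; rewrite nth_nseq ltt (negbTE nt) => /esym.
have ulin : uniq lin by rewrite (perm_uniq pl') iota_uniq.
exact: subseq_index sl ulin tts (ord _ tts _ ut).
Qed.

(** Links the test on the list of pairs, which the parser carries out, with the definition behind
    the width; irreflexivity provides a second task. *)
Lemma isolatedP (t : 'I_n) : isolated t = ~~ nonisolated t.
Proof.
have [_ [_ irr _]] := wfI.
have neq u v : prc u v -> u != v by apply: contraL => /eqP->.
rewrite /isolated; congr negb; apply/hasP/existsP.
  case=> -[u v] uv; have puv : prc u v := uv; have /andP[ltu ltv] := prec_lt puv.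
  case/orP=> /eqP /= e; [exists (Ordinal ltv)|exists (Ordinal ltu)].
    by rewrite -val_eqE /= -e puv eq_sym neq.
  by rewrite -val_eqE /= -e puv orbT neq.
case=> u /andP[_ /orP[tu|ut]].
  by exists (t : nat, u : nat); rewrite //= eqxx.
by exists (u : nat, t : nat); rewrite //= eqxx orbT.
Qed.

Definition maxels (X : bitseq) : {set 'I_n} :=
  [set t | [&& nonisolated t, nth false X t &
               ~~ [exists u : 'I_n, prc t u && nth false X u]]].

(** Among the members of [X] equal to or above [t], take one with most predecessors: by transitivity
    and irreflexivity, anything above it would have more. *)
Lemma maxels_above rp X (t : 'I_n) : reach rp X -> nth false X t -> ~~ isolated t ->
  exists2 m : 'I_n, m \in maxels X & (m == t) || prc t m.
Proof.
move=> re Xt nt.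
pose P (u : 'I_n) := nth false X u && ((u == t) || prc t u).
have Pt : P t by rewrite /P Xt eqxx.
case: (@arg_maxnP _ t P (fun u => #|[set v : 'I_n | prc v u]|) Pt) => m /andP[Xm tm] mmax.
exists m => //; rewrite inE Xm -[nonisolated m]negbK -isolatedP /=; apply/andP; split.
  by case/orP: tm => [/eqP->|/prec_iso/andP[]].
apply/existsP => -[u /andP[mu Xu]].
have [_ [_ irr tr]] := wfI.
have Pu : P u.
  by rewrite /P Xu; case/orP: tm => [/eqP<-|/tr/(_ mu)->]; rewrite ?mu ?orbT.
have /negP[] : ~~ (#|[set v : 'I_n | prc v u]| <= #|[set v : 'I_n | prc v m]|); last exact: mmax.
rewrite -ltnNge; apply: proper_card; apply/properP; split.
  by apply/subsetP => v; rewrite !inE => /tr; apply.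
by exists m; rewrite inE // (negbTE (irr m)).
Qed.

Lemma reach_bound w (L : seq bitseq) : gpo_width I <= w -> uniq L ->
  (forall X, X \in L -> exists rp, reach rp X) -> size L <= n.+1 ^ w.
Proof.
move=> gw uL Lre.
(* Membership is recovered from the maximal elements, by [maxels_above] in one direction and
   down-closure in the other. *)
have nthE X (t : 'I_n) : X \in L ->
    nth false X t = isolated t || [exists m in maxels X, (m == t) || prc t m].
  case/Lre => rp re; apply/idP/orP => [Xt|[iso_t|/existsP[m /andP[]]]].
  - have [iso_t|nt] := boolP (isolated t); first by left.
    right; have [m mX mt] := maxels_above re Xt nt; apply/existsP.
    by exists m; rewrite mX.
  - exact: reach_iso re (ltn_ord t) iso_t.
  - by rewrite inE => /and3P[_ Xm _] /orP[/eqP<-//|/reach_down]; apply; first exact: re.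
have inj : {in L &, injective maxels}.
  move=> X Y XL YL e; have [rp rX] := Lre _ XL; have [rq rY] := Lre _ YL.
  apply: (@eq_from_nth _ false) => [|t].
    by rewrite (reach_size rX) (reach_size rY).
  rewrite (reach_size rX) => ltt.
  by have := nthE X (Ordinal ltt) XL; have := nthE Y (Ordinal ltt) YL; rewrite e /= => -> ->.
rewrite -(size_map maxels) -[n in n.+1 ^ _]card_ord.
apply: leq_trans (card_small_sets _ w).
rewrite cardE; apply: uniq_leq_size; first by rewrite map_inj_in_uniq.
move=> A /mapP[X XL ->]; rewrite mem_enum inE; apply: leq_trans gw.
apply: (leq_bigmax_cond (F := fun S : {set 'I_n} => #|S|)); apply/andP; split.
  by apply/forall_inP => t; rewrite inE => /and3P[].
apply/forall_inP => t; rewrite inE => /and3P[_ Xt /existsPn maxt].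
apply/forall_inP => u; rewrite inE => /and3P[_ Xu /existsPn maxu]; apply/implyP => _.
by have := maxt u; have := maxu t; rewrite Xt Xu !andbT => -> ->.
Qed.

End Instance.

(** * The whole program *)

Definition parse_row a r := parse_list (parse_num rX ;; WriteF a r rX 1).

Definition parse_actions :=
  parse_list (parse_row aPRE rA ;; parse_row aDEL rA ;; parse_row aADD rA ;; Inc rA).
(** Row 0 marks each task as its label is read; [parse_order] unmarks both ends of every pair. What
    remains is the set of isolated tasks, the initial row. *)
Definition parse_labels :=
  parse_list (parse_num rX ;; WriteF aLAB rN rX 1 ;; WriteF aROW 0 rN 1 ;; Inc rN).
Definition parse_order :=
  parse_list (parse_num rX ;; parse_num rY ;; WriteF aPRC rX rY 1 ;;
              WriteF aROW 0 rX 0 ;; WriteF aROW 0 rY 0).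
Definition run_plan :=
  parse_list (parse_num rX ;; exec_step ;; match_step ;; row_step).
Definition final_check :=
  IfF (FEx rT rN (FNot (FArr aUSED 0 rT 1))) (Clr rOk) Skip ;;
  IfF (FEx rR rC (FAll rT rN (FArr aROW rR rT 1))) Skip (Clr rOk).
(** The input length is measured first: it exceeds every number of the input, hence every column
    index, and so can serve as the row length. *)
Definition read_instance :=
  WhileF (FNot (FArr 0 0 rW 0)) (Inc rW) ;; parse_num rX ;;
  parse_actions ;; parse_labels ;; parse_order ;; parse_row aST 0.
Definition pv_prog :=
  read_instance ;; Inc rC ;; Inc rOk ;; run_plan ;; final_check.

(** * Correctness of the parser *)

Section Parsing.

Variables (q : nat) (inp : seq nat).
Local Notation Q := q.+4.
Local Notation wp := (wp q).
Local Notation W := (size inp).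
Hypothesis WQ : W <= Q.

Lemma enc_nat_head v : head 4 (enc_nat v) != 4.
Proof. by case: v. Qed.

Lemma drop_le p y rest : drop p inp = y ++ rest -> y != [::] -> p <= W.
Proof.
case: y => // z y dp _; case: (leqP p W) => // /ltnW /drop_oversize e.
by rewrite e in dp.
Qed.

Lemma reading_mk p l arr : all (fun v => v <= Q) l -> p <= W ->
  nth (fun=> 0) arr 0 = nth 0 inp ->
  reading q inp p (mk_store [:: W, p & l] arr).
Proof.
by move=> lQ pW a0; split=> //; apply: good_mk; rewrite /= lQ WQ (leq_trans pW).
Qed.

Lemma wp_parse_row a rr r xs rest p x l arr (P : store -> Prop) :
  user rr -> rr != 6 -> rr != 7 -> rg (mk_store [:: W, p, x & l] arr) rr = r ->
  0 < a < size arr -> p <= W -> x <= Q -> all (fun v => v <= Q) l ->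
  nth (fun=> 0) arr 0 = nth 0 inp ->
  drop p inp = enc_list enc_nat xs ++ rest ->
  (forall p' x' b, p' <= W -> x' <= Q -> drop p' inp = rest ->
     (forall i c, c < W -> b (i * W + c) =
        if (i == r) && (c \in xs) then 1 else nth (fun=> 0) arr a (i * W + c)) ->
     P (mk_store [:: W, p', x' & l] (set_nth (fun=> 0) arr a b))) ->
  wp (parse_row a rr) (mk_store [:: W, p, x & l] arr) P.
Proof.
move=> urr n6 n7 rr_r /andP[a0 lta] pW xQ lQ arr0 dp Ps.
have rgr p' x' arr' : rg (mk_store [:: W, p', x' & l] arr') rr = r.
  by move: urr n6 n7 rr_r; rewrite /user /=; case: rr => [|[|[|[|[|[|[|[|rr]]]]]]]].
have arr0' b : nth (fun=> 0) (set_nth (fun=> 0) arr a b) 0 = nth 0 inp.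
  by rewrite nth_set_nth /= ltn_eqF.
apply: (wp_parse_list (inp := inp) (enc := enc_nat) WQ
  (Inv := fun done p' s' => exists x' b, [/\ x' <= Q,
    forall i c, c < W -> b (i * W + c) =
      if (i == r) && (c \in done) then 1 else nth (fun=> 0) arr a (i * W + c)
    & s' = mk_store [:: W, p', x' & l] (set_nth (fun=> 0) arr a b)]) _ _ dp) => //.
- exact: enc_nat_head.
- exists x, (nth (fun=> 0) arr a); split=> // [i c _|]; first by rewrite andbF.
  by rewrite setr_mk set_nth_nth.
- move=> done p' _ lep _ [x' [b [xQ' _ ->]]].
  by apply: reading_mk; rewrite //= xQ'.
- move=> done v rest' p' _ lt_done [x' [b [xQ' bP ->]]] dp'.
  have lep' : p' <= W by apply: (drop_le dp'); case: (v).
  apply: wp_seq; apply: (wp_parse_num (inp := inp) (p := p') WQ _ _ dp') => //.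
    by apply: reading_mk; rewrite //= xQ'.
  move=> ltv lepv dpv; rewrite !setr_mk.
  apply: wp_write => //; first by apply: good_mk; rewrite /= lQ; lia.
  rewrite rgr; exists (p' + v.+1) => //.
  rewrite seta_mk; exists v, (fupd b (r * W + v) 1); split; first by lia.
    move=> i c ltc; rewrite /fupd idx_eq // bP // mem_rcons inE.
    by case: (i =P r) => //= _; case: (c =P v).
  by rewrite /= nth_set_nth /= eqxx set_set_nth eqxx.
- move=> p' _ _ ltp dp' [x' [b [xQ' bP ->]]]; rewrite setr_mk.
  exact: Ps.
Qed.

Local Notation z := (fun=> 0).
Local Notation act done k := (nth (Action [::] [::] [::]) done k).

(** Rows not yet written stand for the default action, all of whose lists are empty, so blank arrays
    are correct from the start. *)
Lemma mat_rcons (g : action -> seq nat) done a (b b' : nat -> nat) :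
  g (Action [::] [::] [::]) = [::] ->
  mat W b (fun k f => f \in g (act done k)) ->
  (forall i c, c < W -> b' (i * W + c) =
     if (i == size done) && (c \in g a) then 1 else b (i * W + c)) ->
  mat W b' (fun k f => f \in g (act (rcons done a) k)).
Proof.
move=> g0 bP b'P k f ltf; rewrite b'P // bP // nth_rcons.
case: (ltngtP k (size done)) => [//|ltk|->] /=.
  by rewrite nth_default // ltnW.
by rewrite nth_default // g0; case: (f \in g a).
Qed.

Lemma wp_parse_actions acts rest p x (P : store -> Prop) :
  p <= W -> x <= Q -> drop p inp = enc_list enc_action acts ++ rest ->
  (forall p' x' pre del add, p' <= W -> x' <= Q -> drop p' inp = rest ->
     size acts < W ->
     mat W pre (fun k f => f \in act_pre (act acts k)) ->
     mat W del (fun k f => f \in act_del (act acts k)) ->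
     mat W add (fun k f => f \in act_add (act acts k)) ->
     P (mk_store [:: W; p'; x'; 0; size acts; 0; 0; 0; 0; 0; 0; 0; 0; 0; 0]
           [:: nth 0 inp; pre; del; add; z; z; z; z; z])) ->
  wp parse_actions (mk_store [:: W; p; x; 0; 0; 0; 0; 0; 0; 0; 0; 0; 0; 0; 0]
                       [:: nth 0 inp; z; z; z; z; z; z; z; z]) P.
Proof.
move=> pW xQ dp Ps.
apply: (wp_parse_list (inp := inp) (enc := enc_action) WQ
  (Inv := fun done p' s' => exists x' pre del add, [/\ x' <= Q,
     mat W pre (fun k f => f \in act_pre (act done k)),
     mat W del (fun k f => f \in act_del (act done k)),
     mat W add (fun k f => f \in act_add (act done k))
   & s' = mk_store [:: W; p'; x'; 0; size done; 0; 0; 0; 0; 0; 0; 0; 0; 0; 0]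
              [:: nth 0 inp; pre; del; add; z; z; z; z; z]]) _ _ dp) => //.
- exists x, z, z, z; split=> //; rewrite ?setr_mk //;
    by move=> k f _; rewrite nth_nil.
- move=> done p' _ lep lt_done [x' [pre [del [add [xQ' _ _ _ ->]]]]].
  by apply: reading_mk; rewrite //=; lia.
- move=> done a rest' p' _ lt_done [x' [pre [del [add [xQ' preP delP addP ->]]]]] dp1.
  have {}dp1 : drop p' inp = enc_list enc_nat (act_pre a) ++
    (enc_list enc_nat (act_del a) ++ (enc_list enc_nat (act_add a) ++ rest')).
    by rewrite dp1 /enc_action -!catA.
  have AQ : size done <= Q by lia.
  have lQ : all (fun v => v <= Q) [:: 0; size done; 0; 0; 0; 0; 0; 0; 0; 0; 0; 0].
    by rewrite /= AQ.
  have lep1 : p' <= W by apply: (drop_le dp1).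
  apply: wp_seq; apply: (wp_parse_row (l := _ :: _ :: _) (r := size done)
    _ _ _ _ _ _ _ _ _ dp1) => // {lep1 xQ' dp1 x'}.
  move=> p2 x2 pre' lep2 xQ2 dp2 pre'P.
  apply: wp_seq; apply: (wp_parse_row (l := _ :: _ :: _) (r := size done)
    _ _ _ _ _ _ _ _ _ dp2) => // {lep2 xQ2 dp2 x2}.
  move=> p3 x3 del' lep3 xQ3 dp3 del'P.
  apply: wp_seq; apply: (wp_parse_row (l := _ :: _ :: _) (r := size done)
    _ _ _ _ _ _ _ _ _ dp3) => // {lep3 xQ3 dp3 x3}.
  move=> p4 x4 add' lep4 xQ4 dp4 add'P.
  apply: wp_inc; rewrite setr_mk /=; exists p4 => //.
  exists x4, pre', del', add'; rewrite size_rcons; split=> //.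
  + exact: mat_rcons preP pre'P.
  + exact: mat_rcons delP del'P.
  + exact: mat_rcons addP add'P.
- move=> p' _ lt_acts ltp dp' [x' [pre [del [add [xQ' preP delP addP ->]]]]].
  by rewrite setr_mk /=; apply: Ps.
Qed.

Lemma wp_parse_labels labs rest p x A arrs (P : store -> Prop) :
  p <= W -> x <= Q -> A <= Q -> drop p inp = enc_list enc_nat labs ++ rest ->
  (forall p' x' (lab D : nat -> nat), p' <= W -> x' <= Q -> drop p' inp = rest ->
     size labs < W ->
     mat W lab (fun t k => (t < size labs) && (nth 0 labs t == k)) ->
     (forall t, t < W -> D t = (t < size labs)) ->
     P (mk_store [:: W; p'; x'; 0; A; size labs; 0; 0; 0; 0; 0; 0; 0; 0; 0]
           [:: nth 0 inp; arrs.1.1; arrs.1.2; arrs.2; lab; z; z; z; D])) ->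
  wp parse_labels (mk_store [:: W; p; x; 0; A; 0; 0; 0; 0; 0; 0; 0; 0; 0; 0]
                      [:: nth 0 inp; arrs.1.1; arrs.1.2; arrs.2; z; z; z; z; z]) P.
Proof.
move=> pW xQ AQ dp Ps.
apply: (wp_parse_list (inp := inp) (enc := enc_nat) WQ
  (Inv := fun done p' s' => exists x' (lab D : nat -> nat), [/\ x' <= Q,
     mat W lab (fun t k => (t < size done) && (nth 0 done t == k)),
     (forall t, t < W -> D t = (t < size done))
   & s' = mk_store [:: W; p'; x'; 0; A; size done; 0; 0; 0; 0; 0; 0; 0; 0; 0]
           [:: nth 0 inp; arrs.1.1; arrs.1.2; arrs.2; lab; z; z; z; D]]) _ _ dp) => //.
- exact: enc_nat_head.
- by exists x, z, z; split; rewrite ?setr_mk.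
- move=> done p' _ lep lt_done [x' [lab [D [xQ' _ _ ->]]]].
  by apply: reading_mk; rewrite //=; lia.
- move=> done v rest' p' _ lt_done [x' [lab [D [xQ' labP DP ->]]]] dp'.
  have lep' : p' <= W by apply: (drop_le dp'); case: (v).
  apply: wp_seq; apply: (wp_parse_num (inp := inp) (p := p') WQ _ _ dp') => //.
    by apply: reading_mk; rewrite //=; lia.
  move=> ltv lepv dpv; rewrite !setr_mk /=.
  apply/wp_seq/wp_write => //; first by apply: good_mk; rewrite /=; lia.
  rewrite seta_mk /=.
  apply/wp_seq/wp_write => //; first by apply: good_mk; rewrite /=; lia.
  rewrite seta_mk /=; apply: wp_inc; rewrite setr_mk /=; exists (p' + v.+1) => //.
  eexists v, _, _; rewrite size_rcons; split; last by [].
  + by lia.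
  + move=> t k ltk; rewrite /= /fupd idx_eq // labP // nth_rcons ltnS.
    by case: (ltngtP t (size done)) => //= _; rewrite eq_sym; case: (v == k).
  + move=> t ltt; rewrite /= /fupd add0n DP // ltnS.
    by case: (ltngtP t (size done)).
- move=> p' _ lt_labs ltp dp' [x' [lab [D [xQ' labP DP ->]]]].
  by rewrite setr_mk /=; apply: Ps.
Qed.

Lemma enc_pair_head tt : head 4 (enc_pair tt) != 4.
Proof. by case: tt => -[|u] t. Qed.

Lemma wp_parse_order ord rest p x A n arrs (D0 : nat -> nat) (P : store -> Prop) :
  p <= W -> x <= Q -> A <= Q -> n < W ->
  (forall t, t < W -> D0 t = (t < n)) ->
  drop p inp = enc_list enc_pair ord ++ rest ->
  (forall p' x' y' (prc D : nat -> nat), p' <= W -> x' <= Q -> y' <= Q -> drop p' inp = rest ->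
     mat W prc (fun u t => (u, t) \in ord) ->
     (forall t, t < n -> D t = ~~ has (fun tt => (tt.1 == t) || (tt.2 == t)) ord) ->
     P (mk_store [:: W; p'; x'; y'; A; n; 0; 0; 0; 0; 0; 0; 0; 0; 0]
        [:: nth 0 inp; arrs.1.1.1; arrs.1.1.2; arrs.1.2; arrs.2; prc; z; z; D])) ->
  wp parse_order (mk_store [:: W; p; x; 0; A; n; 0; 0; 0; 0; 0; 0; 0; 0; 0]
     [:: nth 0 inp; arrs.1.1.1; arrs.1.1.2; arrs.1.2; arrs.2; z; z; z; D0]) P.
Proof.
move=> pW xQ AQ nW D0P dp Ps.
apply: (wp_parse_list (inp := inp) (enc := enc_pair) WQ
  (Inv := fun done p' s' => exists x' y' (prc D : nat -> nat), [/\ (x' <= Q) && (y' <= Q),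
     mat W prc (fun u t => (u, t) \in done),
     (forall t, t < n -> D t = ~~ has (fun tt => (tt.1 == t) || (tt.2 == t)) done)
   & s' = mk_store [:: W; p'; x'; y'; A; n; 0; 0; 0; 0; 0; 0; 0; 0; 0]
        [:: nth 0 inp; arrs.1.1.1; arrs.1.1.2; arrs.1.2; arrs.2; prc; z; z; D]]) _ _ dp) => //.
- exact: enc_pair_head.
- exists x, 0, z, D0; rewrite setr_mk; split=> //; first by rewrite xQ.
  by move=> t ltt; rewrite D0P ?ltt //; lia.
- move=> done p' _ lep lt_done [x' [y' [prc [D [xyQ _ _ ->]]]]].
  by apply: reading_mk; rewrite //=; lia.
- move=> done [u t] rest' p' _ lt_done [x' [y' [prc [D [xyQ prcP DP ->]]]]] dp1.
  have {}dp1 : drop p' inp = enc_nat u ++ (enc_nat t ++ rest').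
    by rewrite dp1 /enc_pair -catA.
  have lep1 : p' <= W by apply: (drop_le dp1); case: (u).
  apply: wp_seq; apply: (wp_parse_num (inp := inp) (p := p') WQ _ _ dp1) => //.
    by apply: reading_mk; rewrite //=; lia.
  move=> ltu lepu dp2; rewrite !setr_mk /=.
  apply: wp_seq; apply: (wp_parse_num (inp := inp) (p := p' + u.+1) WQ _ _ dp2) => //.
    by apply: reading_mk; rewrite //=; lia.
  move=> ltt lept dp3; rewrite !setr_mk /=.
  do 2!(apply/wp_seq/wp_write => //; [by apply: good_mk; rewrite /=; lia | rewrite seta_mk /=]).
  apply: wp_write => //; first by apply: good_mk; rewrite /=; lia.
  rewrite seta_mk /=; exists (p' + u.+1 + t.+1) => //.
  eexists u, t, _, _; split; last by [].
  + by lia.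
  + move=> u' t' ltt'; rewrite /= /fupd idx_eq // prcP // mem_rcons inE xpair_eqE.
    by case: ((u' == u) && (t' == t)).
  + move=> v ltv; rewrite /= /fupd !add0n has_rcons DP // negb_or [u == v]eq_sym [t == v]eq_sym.
    by case: (v == t); case: (v == u).
- move=> p' _ lt_ord ltp dp' [x' [y' [prc [D [/andP[xQ' yQ'] prcP DP ->]]]]].
  by rewrite setr_mk /=; apply: Ps.
Qed.

(** Encoded symbols are positive, so the first 0 marks the end. The register being measured is also
    the row length, but in row 0 that factor vanishes. *)
Lemma wp_measure l arr (P : store -> Prop) :
  all (fun a => a != 0) inp -> all (fun v => v <= Q) l ->
  nth (fun=> 0) arr 0 = nth 0 inp ->
  P (mk_store (W :: l) arr) ->
  wp (WhileF (FNot (FArr 0 0 rW 0)) (Inc rW)) (mk_store (0 :: l) arr) P.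
Proof.
move=> /allP inp0 lQ arr0 Ps.
apply: (wp_whilef (k := W) (Inv := fun j s' => j <= W /\ s' = mk_store (j :: l) arr)) => //.
- by move=> j _ [lej ->]; split=> //; apply: good_mk; rewrite /= lQ; lia.
- move=> j _ [lej ->]; rewrite /= nth0 -nth0 arr0 => nz.
  have ltj : j < W by case: ltnP nz => // gej; rewrite nth_default.
  by split=> //; apply: wp_inc; rewrite setr_mk.
- move=> j _ _ [lej ->]; rewrite /= nth0 -nth0 arr0 negbK => /eqP z_j.
  case: (ltnP j W) => [ltj|gej]; last by have -> : j = W by lia.
  by have := inp0 _ (mem_nth 0 ltj); rewrite z_j.
Qed.

End Parsing.

Section Main.

Variable I : instance.
Hypothesis wfI : wf_instance I.
Variable q : nat.
Local Notation Q := q.+4.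
Local Notation wp := (wp q).
Local Notation inp := (encode I).
Local Notation W := (size inp).
Local Notation n := (ntasks I).
Hypothesis WQ : W <= Q.
Local Notation z := (fun=> 0).

Lemma encode_pos : all (fun a => (0 < a) && (a < 5)) inp.
Proof.
have num v : all (fun a => (0 < a) && (a < 5)) (enc_nat v).
  by rewrite all_cat all_nseq orbT.
have lst (T : Type) (f : T -> seq nat) xs :
    (forall x, all (fun a => (0 < a) && (a < 5)) (f x)) ->
    all (fun a => (0 < a) && (a < 5)) (enc_list f xs).
  move=> fP; rewrite all_cat all_cat /= andbT.
  by elim: xs => //= x xs; rewrite all_cat fP.
have act a : all (fun a => (0 < a) && (a < 5)) (enc_action a).
  by rewrite /enc_action; do 2!(rewrite all_cat lst // andTb); apply: lst.
have pair tt : all (fun a => (0 < a) && (a < 5)) (enc_pair tt).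
  by rewrite /enc_pair all_cat !num.
by rewrite /encode all_cat num andTb; do 4!(rewrite all_cat lst // andTb); apply: lst.
Qed.

Definition parsed_store p x y cnt ok (pre del add lab prc S D : nat -> nat) :=
  mk_store [:: W; p; x; y; size (inst_actions I); n; cnt; ok; 0; 0; 0; 0; 0; 0; 0]
     [:: nth 0 inp; pre; del; add; lab; prc; S; z; D].

Lemma wp_read_instance (P : store -> Prop) :
  (forall p x y (pre del add lab prc S D : nat -> nat), p <= W -> x <= Q -> y <= Q ->
     size (inst_actions I) < W -> n < W -> inst_nprops I < W ->
     drop p inp = enc_list enc_nat (inst_plan I) ->
     mat W pre (fun k f => f \in act_pre (action_of I k)) ->
     mat W del (fun k f => f \in act_del (action_of I k)) ->
     mat W add (fun k f => f \in act_add (action_of I k)) ->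
     mat W lab (fun t k => (t < n) && (alpha I t == k)) ->
     mat W prc (prec I) ->
     (forall f, f < W -> S f = (f \in inst_init I)) ->
     (forall t, t < n -> D t = isolated I t) ->
     P (parsed_store p x y 0 0 pre del add lab prc S D)) ->
  wp read_instance (mk_store [:: 0; 0; 0; 0; 0; 0; 0; 0; 0; 0; 0; 0; 0; 0; 0]
                       [:: nth 0 inp; z; z; z; z; z; z; z; z]) P.
Proof.
move=> Ps.
apply/wp_seq/(wp_measure WQ) => //.
  by apply: sub_all encode_pos => a /andP[]; rewrite lt0n.
have dp0 : drop 0 inp = enc_nat (inst_nprops I) ++ (enc_list enc_action (inst_actions I)
  ++ (enc_list enc_nat (inst_labels I) ++ (enc_list enc_pair (inst_order I)
  ++ (enc_list enc_nat (inst_init I) ++ enc_list enc_nat (inst_plan I))))).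
  by rewrite drop0.
apply: wp_seq; apply: (wp_parse_num (inp := inp) (p := 0) WQ _ _ dp0) => //.
  by apply: reading_mk.
move=> lt_np lep1 dp1; rewrite !setr_mk /= in lep1 dp1 *.
apply: wp_seq; apply: (wp_parse_actions WQ _ _ dp1) => //; first by lia.
move=> p2 x2 pre del add lep2 xQ2 dp2 lt_acts preP delP addP.
have AQ : size (inst_actions I) <= Q by lia.
apply: wp_seq; apply: (wp_parse_labels (arrs := (pre, del, add)) WQ _ _ _ dp2) => //.
move=> p3 x3 lab D0 lep3 xQ3 dp3 lt_labs labP D0P.
apply: wp_seq; apply: (wp_parse_order (arrs := (pre, del, add, lab)) WQ _ _ _ _ _ dp3) => //.
move=> p4 x4 y4 prc D lep4 xQ4 yQ4 dp4 prcP DP.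
apply: (wp_parse_row (l := _ :: _ :: _) (r := 0) WQ _ _ _ _ _ _ _ _ _ dp4) => //.
  by rewrite /= yQ4 AQ; lia.
move=> p5 x5 S lep5 xQ5 dp5 SP; apply: Ps => //.
by move=> f ltf; have := SP 0 f ltf; rewrite /= => ->; case: ifP.
Qed.

End Main.

Lemma executable_cat s p1 p2 :
  executable s (p1 ++ p2) =
  executable s p1 && executable (foldl (fun s a => apply_action a s) s p1) p2.
Proof. by elim: p1 s => //= a p1 IH s; rewrite IH andbA. Qed.

(** * Correctness of the scan through the plan *)

Section Plan.

Variable I : instance.
Hypothesis wfI : wf_instance I.
Variables q w : nat.
Hypothesis gpoI : gpo_width I <= w.
Local Notation Q := q.+4.
Local Notation wp := (wp q).
Local Notation inp := (encode I).
Local Notation W := (size inp).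
Local Notation n := (ntasks I).
Local Notation A := (size (inst_actions I)).
Hypotheses (WQ : W <= Q) (boundQ : n.+1 ^ w < Q).
Hypotheses (nW : n < W) (AW : A < W) (FW : inst_nprops I < W).

Variables (pre del add lab prc : nat -> nat) (y : nat).
Hypothesis yQ : y <= Q.
Hypothesis preP : mat W pre (fun k f => f \in act_pre (action_of I k)).
Hypothesis delP : mat W del (fun k f => f \in act_del (action_of I k)).
Hypothesis addP : mat W add (fun k f => f \in act_add (action_of I k)).
Hypothesis labP : mat W lab (fun t k => (t < n) && (alpha I t == k)).
Hypothesis prcP : mat W prc (prec I).

Local Notation plan_store := (plan_store W n (nth 0 inp) pre del add lab prc).
Local Notation rows := (rows W n).
Local Notation s0 := (fun f => f \in inst_init I).
Local Notation reach := (reach I).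

Definition acts (p : seq nat) := map (action_of I) p.
Definition sstate p := foldl (fun s a => apply_action a s) s0 (acts p).
Definition used_tasks (used : nat -> nat) := [seq t <- iota 0 n | used t == 1].

(** A false verdict is a statement about all continuations of the prefix, so it is final. *)
Definition plan_ok p (ok : bool) used :=
  if ok then executable s0 (acts p) /\ perm_eq (map (alpha I) (used_tasks used)) p
  else forall r, ~ (executable s0 (acts (p ++ r)) /\ perm_eq (inst_labels I) (p ++ r)).

Lemma sstate_rcons p k : sstate (rcons p k) = apply_action (action_of I k) (sstate p).
Proof. by rewrite /sstate /acts map_rcons foldl_rcons. Qed.

Lemma plan_ok_exec p k ok used :
  plan_ok p ok used -> ~~ (ok && all (sstate p) (act_pre (action_of I k))) ->
  forall r, ~ (executable s0 (acts (p ++ k :: r)) /\ perm_eq (inst_labels I) (p ++ k :: r)).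
Proof.
case: ok => /= [_ nall|H _] r; last exact: H.
by rewrite /acts map_cat executable_cat /= -/(acts p) -/(sstate p) (negbTE nall) andbF => -[].
Qed.

(** When every task labelled [k] is used, [p] contains [k] as often as the labels do, so no list
    beginning with [p] and another [k] can be a permutation of them. *)
Lemma plan_ok_none p k ok used : plan_ok p ok used ->
  (forall t, t < n -> ~~ ((alpha I t == k) && (used t != 1))) ->
  plan_ok (rcons p k) false used.
Proof.
move=> pok none r; rewrite cat_rcons.
case: ok pok => [[_ pu]|H]; last exact: H.
case=> _ pl.
have cE : count_mem k (map (alpha I) (iota 0 n)) = count_mem k (map (alpha I) (used_tasks used)).
  have pe : perm_eq (used_tasks used ++ [seq t <- iota 0 n | used t != 1]) (iota 0 n).
    by rewrite perm_filterC.
  have /permP <- := perm_map (alpha I) pe; rewrite map_cat count_cat -[RHS]addn0.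
  congr addn; rewrite count_map; apply/eqP; rewrite -leqn0 leqNgt -has_count.
  apply/hasPn => t; rewrite mem_filter mem_iota => /= /andP[nut ltt].
  by have := none t ltt; rewrite nut andbT.
move: cE; rewrite map_alpha_iota (permP pl) (permP pu) count_cat /= eqxx; lia.
Qed.

Lemma plan_ok_some p k t ok used : plan_ok p ok used -> t < n ->
  alpha I t = k -> used t != 1 ->
  plan_ok (rcons p k) (ok && all (sstate p) (act_pre (action_of I k))) (fupd used t 1).
Proof.
move=> pok ltt def_k nut.
case: (boolP (ok && _)) => [/andP[okT allT]|nall]; last first.
  by move=> r; rewrite cat_rcons; apply: plan_ok_exec pok nall r.
rewrite okT in pok; case: pok => ex pu; split.
  by rewrite /acts map_rcons -cats1 executable_cat ex /= -/(acts p) -/(sstate p) allT.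
have pt : perm_eq (used_tasks (fupd used t 1)) (t :: used_tasks used).
  apply: uniq_perm; rewrite /= ?mem_filter ?filter_uniq ?iota_uniq ?(negbTE nut) //.
  move=> u; rewrite inE !mem_filter mem_iota /fupd.
  by case: (u =P t) => [->|].
rewrite (permPl (perm_map _ pt)) /= def_k -cats1 perm_sym.
by rewrite perm_catC /= perm_cons perm_sym.
Qed.

Definition rows_ok p c D :=
  uniq (rows D c) /\ forall X, X \in rows D c <-> reach (rev p) X.

(** After each prefix the rows are exactly the reachable sets, without repetition, so [reach_bound]
    keeps their number below [Q]. *)
Lemma wp_run_plan p x (S D : nat -> nat) (P : store -> Prop) :
  p <= W -> x <= Q -> drop p inp = enc_list enc_nat (inst_plan I) ->
  (forall f, f < W -> S f = (f \in inst_init I)) ->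
  (forall t, t < n -> D t = isolated I t) ->
  (forall p' x' c ok S' used D', p' <= Q -> x' <= Q -> c <= Q ->
     plan_ok (inst_plan I) ok used -> rows_ok (inst_plan I) c D' ->
     P (plan_store p' x' y A c ok 0 0 0 0 0 0 0 S' used D')) ->
  wp run_plan (plan_store p x y A 1 true 0 0 0 0 0 0 0 S (fun=> 0) D) P.
Proof.
move=> pW xQ dp S0 D0 Ps.
have rows_bound c D' p' : rows_ok p' c D' -> c < Q.
  case=> ur rr; rewrite -(size_rows W n D' c).
  apply: leq_ltn_trans (reach_bound wfI gpoI ur _) boundQ.
  by move=> X /rr rX; exists (rev p').
rewrite -[enc_list _ _]cats0 in dp.
apply: (wp_parse_list (inp := inp) (enc := enc_nat) WQ
  (Inv := fun done p' s' => exists x' c ok (S' used D' : nat -> nat),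
   [/\ x' <= Q, forall f, f < W -> S' f = sstate done f,
       plan_ok done ok used, rows_ok done c D'
     & s' = plan_store p' x' y A c ok 0 0 0 0 0 0 0 S' used D']) _ _ dp) => //.
- exact: enc_nat_head.
- exists x, 1, true, S, (fun=> 0), D; rewrite setr_mk; split=> //.
    by split=> //; rewrite /used_tasks /= (eq_filter (a2 := pred0)) ?filter_pred0.
  split=> // X; rewrite /= inE.
  have -> : row W n D 0 = row0 I.
    by apply/eq_in_map => t; rewrite mem_iota /= => ltt; rewrite mul0n D0 // eqb1.
  by split=> [/eqP|->].
- move=> done p' _ lep lt_done [x' [c [ok [S' [used [D' [xQ' _ _ rok ->]]]]]]].
  apply: reading_mk => //=; have := rows_bound _ _ _ rok; case: (ok); lia.
- move=> done k rest p' _ lt_done [x' [c [ok [S' [used [D' [xQ' S'P pok rok ->]]]]]]] dp'.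
  have cQ := rows_bound _ _ _ rok.
  have lep' : p' <= W by apply: (drop_le dp'); case: (k).
  apply: wp_seq; apply: (wp_parse_num (inp := inp) (p := p') WQ _ _ dp') => //.
    by apply: reading_mk => //=; case: (ok); lia.
  move=> ltk lepk dpk; rewrite /plan_store !setr_mk /=.
  rewrite -/(plan_store _ _ _ _ _ _ _ _ _ _ _ _ _ _ _ _).
  have kQ : p' + k.+1 <= Q by lia.
  have AQ : A <= Q by lia.
  have preW : all (fun f => f < W) (act_pre (action_of I k)).
    have [[props _ _ _] _] := wfI.
    (* An index past the list denotes the default action, whose precondition is empty. *)
    case: (ltnP k A) => [ltkA|gek]; last by rewrite /action_of nth_default.
    have /and3P[pre_k _ _] := all_nthP (Action [::] [::] [::]) props k ltkA. 
    by apply: sub_all pre_k => f /ltn_trans; apply.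
  apply: wp_seq; apply: (wp_exec_step WQ nW preP delP addP _ _ _ _ _ _ S'P) => //; first by lia.
  move=> S2 S2P.
  have row_case ok' used' : plan_ok (rcons done k) ok' used' ->
      wp row_step (plan_store (p' + k.+1) k y A c ok' 0 0 0 0 0 0 0 S2 used' D')
      (fun s2 => exists2 p2, drop p2 inp = rest & exists x' c ok (S' used D' : nat -> nat),
   [/\ x' <= Q, forall f, f < W -> S' f = sstate (rcons done k) f,
       plan_ok (rcons done k) ok used, rows_ok (rcons done k) c D'
     & s2 = plan_store p2 x' y A c ok 0 0 0 0 0 0 0 S' used D']).
    move=> pok'; have [ur rr] := rok.
    have Xre X : X \in rows D' c -> reach (rev done) X by move/rr.
    have L_re M X : (forall X, X \in M -> succ n (alpha I) (prec I) k (rows D' c) X) ->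
        X \in rows D' c ++ M -> reach (rev (rcons done k)) X.
      move=> sM; rewrite mem_cat rev_rcons /= => /orP[/Xre|/sM[Y [t [/Xre]]]]; first by left.
      by right; exists Y, t.
    apply: (wp_row_step (lab := alpha I) (prc := prec I) WQ nW) => //.
    - by move=> t j ltt ltj; rewrite labP ?ltt.
    - move=> M uM sM; apply: leq_ltn_trans (reach_bound wfI gpoI uM _) boundQ.
      by move=> X /(L_re _ _ sM) rX; exists (rev (rcons done k)).
    - move=> D2 M rD2 uM sM cM; exists (p' + k.+1) => //.
      exists k, (c + size M), ok', S2, used', D2; split=> //; first by lia.
        by move=> f ltf; rewrite S2P // sstate_rcons.
      rewrite /rows_ok rD2; split=> // X; split; first exact: L_re.
      rewrite rev_rcons /= => -[/rr|[Y [t [/rr YL ltt cYt ->]]]]; last exact: cM.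
      by rewrite mem_cat => ->.
  apply: wp_seq; apply: (wp_match_step (lab := alpha I) WQ nW) => //.
  + by move=> t j ltt ltj; rewrite labP ?ltt.
  + lia.
  + by move=> none; apply: row_case; apply: plan_ok_none pok none.
  + move=> t ltt /andP[/eqP def_k nut]; apply: row_case.
    exact: plan_ok_some pok ltt def_k nut.
- move=> p' _ lt_plan ltp dp' [x' [c [ok [S' [used [D' [xQ' _ pok rok ->]]]]]]].
  rewrite /plan_store setr_mk /=; apply: Ps => //; first by lia.
  by have := rows_bound _ _ _ rok; lia.
Qed.

Lemma wp_final_check p x c (ok : bool) S used D (P : store -> Prop) :
  p <= Q -> x <= Q -> c <= Q ->
  P (plan_store p x y A c [&& ok, all (fun t => used t == 1) (iota 0 n)
                     & nseq n true \in rows D c] 0 0 0 0 0 0 0 S used D) ->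
  wp final_check (plan_store p x y A c ok 0 0 0 0 0 0 0 S used D) P.
Proof.
move=> pQ xQ cQ Ps; have AQ : A <= Q by lia.
pose ok1 := ok && all (fun t => used t == 1) (iota 0 n).
have {Ps} wp2 : wp (IfF (FEx rR rC (FAll rT rN (FArr aROW rR rT 1))) Skip (Clr rOk))
    (plan_store p x y A c ok1 0 0 0 0 0 0 0 S used D) P.
  apply: wp_iff => //; first by apply: good_mk; rewrite /=; case: (ok1); lia.
  set b := eval _ _; have {b}-> : b = (nseq n true \in rows D c).
    rewrite /b /=; apply/hasP/mapP => -[r rc e]; exists r => //.
      apply/esym/row_eq => [|t ltt]; first by rewrite size_nseq.
      by move/hasPn: e => /(_ t); rewrite mem_iota ltt nth_nseq ltt negbK => ->.
    apply/hasPn => t; rewrite mem_iota => /andP[_ ltt].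
    by rewrite negbK -(nth_row W D r ltt) -e nth_nseq ltt.
  move: Ps; rewrite andbA -/ok1; case: (_ \in _) => Ps.
    by apply: wp_skip; rewrite andbT in Ps.
  by apply: wp_clr; rewrite andbF in Ps; rewrite /plan_store setr_mk.
apply/wp_seq/wp_iff => //; first by apply: good_mk; rewrite /=; case: (ok); lia.
rewrite /= has_predC; rewrite /ok1 in wp2; case: all wp2 => /= wp2.
  by apply: wp_skip; rewrite andbT in wp2.
by apply: wp_clr; rewrite andbF in wp2; rewrite /plan_store setr_mk.
Qed.

(** Under a true verdict the labels of the used tasks form the plan up to order. All tasks being
    used, these are all labels; conversely, equal lengths force all tasks to be used. *)
Lemma final_ok ok used c D :
  plan_ok (inst_plan I) ok used -> rows_ok (inst_plan I) c D ->
  [&& ok, all (fun t => used t == 1) (iota 0 n) & nseq n true \in rows D c] <-> PV_yes I.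
Proof.
move=> pok [_ rr]; rewrite (PV_yesP wfI); split.
  case: ok pok => // -[ex pu] /and3P[_ /all_filterP all_u /rr re]; split=> //.
  by rewrite -map_alpha_iota -all_u.
case=> ex pl re; case: ok pok => [[_ pu]|/(_ [::])]; last by rewrite cats0; case.
rewrite /=; apply/andP; split; last by apply/rr.
rewrite all_count size_iota -size_filter -/(used_tasks used) -(size_map (alpha I)).
by rewrite (perm_size pu) -(perm_size pl).
Qed.

End Plan.

(** * The polynomial time bound and the theorem *)

Lemma machine_nsyms K prog : 0 < K -> 4 < tm_nsyms (machine K prog).
Proof. by case: K => // K _; rewrite /= expnS leq_pmulr // expn_gt0. Qed.

Lemma leq_expl d m n : m <= n -> m ^ d <= n ^ d.
Proof. by move=> lemn; elim: d => // d IH; rewrite !expnS leq_mul. Qed.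

(** With [b] the bound on [m], the left side is at most [20 * b ^ 2], which 32 covers. The 6 is
    [1 + 1 + 4]: each summand of [W ^ w + W + 4] is at most its coefficient times [W ^ w.+1]. *)
Lemma time_bound w W d m : 0 < W -> m <= (W ^ w + W).+4 ^ d ->
  2 * m.+1 ^ 2 + 6 * m.+1 <= 32 * 6 ^ (d * 2) * W ^ (w.+1 * d * 2).
Proof.
move=> W0 lem; set b := (_ ^ d) in lem.
have b_gt0 : 0 < b by rewrite expn_gt0.
apply: (@leq_trans (32 * b ^ 2)); first by rewrite -!mulnn; nia.
rewrite -mulnA leq_mul2l /= !expnM -!expnMn; do 2!apply: leq_expl.
apply: leq_trans (_ : W ^ w.+1 + W ^ w.+1 + 4 * W ^ w.+1 <= _); last by lia.
have W1 : 0 < W ^ w by rewrite expn_gt0 W0.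
by rewrite expnS; nia.
Qed.

Theorem theorem5 :
  forall w : nat,
  exists M : TM,
    tm_wf M /\ 4 < tm_nsyms M /\
    exists c k : nat,
      forall I : instance,
        wf_instance I -> gpo_width I <= w ->
        let x := encode I in
        let C := run M (c * size x ^ k + c) x in
        halted M C /\ (cstate C = tm_accept M <-> PV_yes I).
Proof.
(* The highest register, 19, lies on track 39 and the highest array, 8, on track 16. The machine
   does not mention [w]. *)
move=> w; exists (decider 40 pv_prog rOk).
split; first exact: machine_wf.
split; first exact: machine_nsyms.
pose d := deg pv_prog; have def_d : d = deg pv_prog by [].
clearbody d; exists (32 * 6 ^ (d * 2)), (w.+1 * d * 2) => I wfI gI.
(* This [q] makes [Q] exceed both the input length and, since there are fewer tasks than input
   symbols, the number of reachable sets. *)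
set x := encode I; pose q := size x ^ w + size x.
have x5 := encode_pos I.
have x_gt0 : 0 < size x by rewrite /x /encode; case: (inst_nprops I).
have WQ : size x <= q.+4 by rewrite /q; lia.
have [m [s [lem ex [s0 sok]]]] : wp q pv_prog (istore x)
    (fun s => rg s 0 = 0 /\ (0 < rg s rOk <-> PV_yes I)).
  have -> : istore x = mk_store [:: 0; 0; 0; 0; 0; 0; 0; 0; 0; 0; 0; 0; 0; 0; 0]
      [:: nth 0 x; fun=> 0; fun=> 0; fun=> 0; fun=> 0; fun=> 0; fun=> 0; fun=> 0; fun=> 0].
    apply: store_ext => [r|a i]; first by do 20!(case: r => [//|r]); rewrite /= nth_nil.
    by do 9!(case: a => [//|a]); rewrite /= nth_nil.
  apply: wp_seq; apply: (wp_read_instance WQ).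
  move=> p r y pre del add lab prc S D pW rQ yQ AW nW FW dp preP delP addP labP prcP SP DP.
  (* Setting [rC] to 1 turns row 0, left by the parser, into the initial list; the verdict starts as
     true. *)
  apply/wp_seq/wp_inc/wp_seq/wp_inc; rewrite /parsed_store !setr_mk /=.
  have boundQ : (ntasks I).+1 ^ w < q.+4.
    have := leq_expl w nW; rewrite -/x.
    set a := _ ^ w; set b := _ ^ w; rewrite /q -/b; clearbody a b; lia.
  apply: wp_seq; apply: (wp_run_plan wfI gI WQ boundQ nW AW FW yQ preP delP addP labP
    prcP pW rQ dp SP DP).
  move=> p' r' c ok S' used D' pQ' rQ' cQ pok rok.
  apply: (wp_final_check gI WQ boundQ nW AW FW yQ) => //.
  split=> //; rewrite -(final_ok wfI pok rok) /=.
  by case: [&& _, _ & _].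
rewrite -def_d in lem.
apply: decider_ok x_gt0 ex s0 sok (leq_trans (time_bound x_gt0 lem) (leq_addr _ _)) => //.
by apply: sub_all x5 => a /andP[].
Qed.
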